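(* For $S=\{p^{(1)},\dots,p^{(m)}\}\subset\mathbb{R}^n/\mathbb{R}\mathbf{1}$, the Fréchet mean polytrope $\overline{S}$ of $S$ can be computed exactly in $\mathcal{O}\left(2^{mn^2+n}\cdot(mn^3)\right)$ steps; that is, there is an algorithm which, given $S$, computes $\overline{S}$ exactly using this many steps.
   Context: $\mathbf{1}=(1,\dots,1)$, and $\mathbb{R}^n/\mathbb{R}\mathbf{1}$ is the tropical projective torus, the quotient of $\mathbb{R}^n$ identifying vectors that differ by a real multiple of $\mathbf{1}$. The tropical metric is $d_{\mathrm{tr}}(x,y)=\max_i(x_i-y_i)-\min_i(x_i-y_i)$. A tropical Fréchet mean of $S$ is a point minimizing $c(x)=\sum_{\nu=1}^m d_{\mathrm{tr}}(x,p^{(\nu)})^2$ over $x\in\mathbb{R}^n/\mathbb{R}\mathbf{1}$, and the Fréchet mean polytrope (FM polytrope) $\overline{S}$ is the set of all tropical Fréchet means of $S$. ''Steps'' are elementary exact arithmetic operations and comparisons on real numbers; computing $\overline{S}$ exactly means outputting an exact description of this set by finitely many affine-linear equations and inequalities. *)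

(* Defs.v *)
From HB Require Import structures.
From mathcomp Require Import all_boot all_order all_algebra.
From mathcomp Require Import generic_quotient.
From mathcomp Require Import classical_sets reals.

Set Implicit Arguments.
Unset Strict Implicit.
Unset Printing Implicit Defensive.

Import Order.TTheory GRing.Theory Num.Theory.
Local Open Scope classical_set_scope.
Local Open Scope quotient_scope.
Local Open Scope ring_scope.

(* Coordinates are indexed by 'I_n.+1, so the ambient dimension is n.+1 >= 1
   and maxima and minima of coordinates exist; torus R n is R^(n+1) / R 1. *)

Section TropicalTorus.
Variables (R : realType) (n : nat).
Implicit Types x y z : 'rV[R]_n.+1.

Definition ones : 'rV[R]_n.+1 := const_mx 1.

(* (u <= v)%MS on row vectors says that u is a scalar multiple of v. *)
Definition torus_eq x y : bool := (x - y <= ones)%MS.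

Lemma torus_eqP x y : reflect (exists a, x - y = a *: ones) (torus_eq x y).
Proof. exact: sub_rVP. Qed.

Lemma torus_eq_refl : reflexive torus_eq.
Proof. by move=> x; rewrite /torus_eq subrr sub0mx. Qed.

Lemma torus_eq_sym : symmetric torus_eq.
Proof. by move=> x y; rewrite /torus_eq -opprB eqmx_opp. Qed.

Lemma torus_eq_trans : transitive torus_eq.
Proof.
move=> y x z xy yz; rewrite /torus_eq.
have -> : x - z = (x - y) + (y - z) by rewrite addrA subrK.
exact: addmx_sub.
Qed.

Canonical torus_equiv :=
  EquivRel torus_eq torus_eq_refl torus_eq_sym torus_eq_trans.

Definition torus := {eq_quot torus_equiv}.
HB.instance Definition _ := Choice.on torus.
HB.instance Definition _ := EqQuotient.on torus.

Definition coord_max z : R := \big[Num.max/z ord0 ord0]_i z ord0 i.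
Definition coord_min z : R := \big[Num.min/z ord0 ord0]_i z ord0 i.

Definition vec_dtr x y : R := coord_max (x - y) - coord_min (x - y).

Lemma coord_maxD z a : coord_max (z + a *: ones) = coord_max z + a.
Proof.
rewrite /coord_max (big_morph (+%R^~ a) (op1 := Num.max)
  (fun u v => addr_maxl u v a) (erefl (z ord0 ord0 + a))).
by rewrite !mxE mulr1; apply: eq_bigr => i _; rewrite !mxE mulr1.
Qed.

Lemma coord_minD z a : coord_min (z + a *: ones) = coord_min z + a.
Proof.
rewrite /coord_min (big_morph (+%R^~ a) (op1 := Num.min)
  (fun u v => addr_minl u v a) (erefl (z ord0 ord0 + a))).
by rewrite !mxE mulr1; apply: eq_bigr => i _; rewrite !mxE mulr1.
Qed.

Definition dtr (u v : torus) : R := vec_dtr (repr u) (repr v).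

Lemma dtr_pi x y : dtr (\pi_torus x) (\pi_torus y) = vec_dtr x y.
Proof.
have reprP z : exists a, repr (\pi_torus z) = z + a *: ones.
  have /eqmodP/torus_eqP[a e] : repr (\pi_torus z) = z %[mod torus].
    by rewrite reprK.
  by exists a; rewrite -e addrC subrK.
rewrite /dtr /vec_dtr; have [a ->] := reprP x; have [b ->] := reprP y.
have -> : x + a *: ones - (y + b *: ones) = x - y + (a - b) *: ones.
  by rewrite scalerBl opprD addrACA.
by rewrite coord_maxD coord_minD opprD addrACA subrr addr0.
Qed.

Definition frechet_cost (m : nat) (S : 'I_m -> torus) (u : torus) : R :=
  \sum_(nu < m) dtr u (S nu) ^+ 2.

Definition FM_polytope (m : nat) (S : 'I_m -> torus) : set torus :=
  [set u | forall v : torus, frechet_cost S u <= frechet_cost S v].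

End TropicalTorus.

(* Uniform algorithms over the reals: programs of a real random access
   machine, with natural-number index variables and two-dimensional arrays of
   reals, both named by numbers.  The only real constants are 0 and 1, and
   there is no rounding and no conversion from reals to indices.  Index
   arithmetic has no multiplication, so that an index gains at most one bit
   per charged operation. *)

Inductive iexp : Type :=
| IConst of nat
| IVar of nat
| IAdd of iexp & iexp
| ISub of iexp & iexp.

Inductive rexp : Type :=
| RZero
| ROne
| RCell of nat & iexp & iexp
| RAdd of rexp & rexp
| RSub of rexp & rexp
| RMul of rexp & rexp.

Inductive test : Type :=
| ILe of iexp & iexp
| RLe of rexp & rexp
| Not of test.

Inductive cmd : Type :=
| Skip
| ISet (x : nat) (e : iexp)
| RSet (a : nat) (i j : iexp) (e : rexp)
| RDiv (a : nat) (i j : iexp) (e f : rexp)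
| Seq (c d : cmd)
| If (b : test) (c d : cmd)
| While (b : test) (c : cmd).

(* Every operation, constant, variable access and array access is charged
   one step, so the step counts below bound in particular the number of
   arithmetic operations and comparisons on reals. *)

Fixpoint icost (e : iexp) : nat :=
  match e with
  | IConst _ | IVar _ => 1
  | IAdd e f | ISub e f => (icost e + icost f).+1
  end%N.

Fixpoint rcost (e : rexp) : nat :=
  match e with
  | RZero | ROne => 1
  | RCell _ i j => (icost i + icost j).+1
  | RAdd e f | RSub e f | RMul e f => (rcost e + rcost f).+1
  end%N.

Fixpoint tcost (b : test) : nat :=
  match b with
  | ILe e f => (icost e + icost f).+1
  | RLe e f => (rcost e + rcost f).+1
  | Not b => (tcost b).+1
  end%N.

Section Semantics.
Variable R : realType.

Record state : Type := State {
  ivar : nat -> nat;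
  cell : nat -> nat -> nat -> R
}.

Implicit Type s : state.

Definition set_ivar s (x k : nat) : state :=
  State (fun y => if y == x then k else ivar s y) (cell s).

Definition set_cell s (a i j : nat) (r : R) : state :=
  State (ivar s) (fun a' i' j' =>
    if [&& a' == a, i' == i & j' == j] then r else cell s a' i' j').

Fixpoint ieval s (e : iexp) : nat :=
  match e with
  | IConst k => k
  | IVar x => ivar s x
  | IAdd e f => (ieval s e + ieval s f)%N
  | ISub e f => (ieval s e - ieval s f)%N
  end.

Fixpoint reval s (e : rexp) : R :=
  match e with
  | RZero => 0
  | ROne => 1
  | RCell a i j => cell s a (ieval s i) (ieval s j)
  | RAdd e f => reval s e + reval s f
  | RSub e f => reval s e - reval s f
  | RMul e f => reval s e * reval s f
  end.

Fixpoint teval s (b : test) : bool :=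
  match b with
  | ILe e f => (ieval s e <= ieval s f)%N
  | RLe e f => reval s e <= reval s f
  | Not b => ~~ teval s b
  end.

(* exec c s s' t: started in s, the program c halts in s' after t steps.
   Division by zero has no rule: such a run is stuck. *)
Inductive exec : cmd -> state -> state -> nat -> Prop :=
| ExecSkip s : exec Skip s s 1
| ExecISet s x e :
    exec (ISet x e) s (set_ivar s x (ieval s e)) (icost e).+1
| ExecRSet s a i j e :
    exec (RSet a i j e) s
      (set_cell s a (ieval s i) (ieval s j) (reval s e))
      (icost i + icost j + rcost e).+1
| ExecRDiv s a i j e f :
    reval s f != 0 ->
    exec (RDiv a i j e f) s
      (set_cell s a (ieval s i) (ieval s j) (reval s e / reval s f))
      (icost i + icost j + rcost e + rcost f).+2
| ExecSeq s s' s'' c d t u :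
    exec c s s' t -> exec d s' s'' u -> exec (Seq c d) s s'' (t + u)
| ExecIfTrue s s' b c d t :
    teval s b -> exec c s s' t -> exec (If b c d) s s' (tcost b + t)
| ExecIfFalse s s' b c d t :
    ~~ teval s b -> exec d s s' t -> exec (If b c d) s s' (tcost b + t)
| ExecWhileTrue s s' s'' b c t u :
    teval s b -> exec c s s' t -> exec (While b c) s' s'' u ->
    exec (While b c) s s'' (tcost b + t + u)
| ExecWhileFalse s b c :
    ~~ teval s b -> exec (While b c) s s (tcost b).

Lemma exec_det c s s1 s2 t1 t2 :
  exec c s s1 t1 -> exec c s s2 t2 -> s1 = s2 /\ t1 = t2.
Proof.
move=> e1; elim: e1 s2 t2 => {c s s1 t1} /=; intros;
  match goal with H : exec _ _ ?s2 ?t2 |- _ = ?s2 /\ _ = ?t2 =>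
    inversion H; subst
  end => //; try by [congruence | lazymatch goal with
    H : is_true ?b, H' : is_true (~~ ?b) |- _ => by rewrite H in H' end];
  repeat match goal with
    IH : (forall s2 t2, exec ?c ?s s2 t2 -> _), H : exec ?c ?s _ _ |- _ =>
      let e := fresh in have [? e] := IH _ _ H; clear IH; subst
    end => //.
Qed.

(* Input: index variables 0 and 1 hold the number m of points and the
   dimension n; row nu of array 0 holds the coordinates of the nu-th point.
   Everything else is 0. *)
Definition input (m n : nat) (p : 'I_m -> 'rV[R]_n) : state :=
  State
    (fun x => if x == 0%N then m else if x == 1%N then n else 0%N)
    (fun a i j =>
       if a == 0%N then
         if (insub i, insub j) is (Some nu, Some k) then p nu ord0 k else 0
       else 0).

(* Output: index variables 0 and 1 hold the numbers of equations and of
   inequalities.  Row k of array 1 (resp. 2) is the k-th equation (resp.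
   inequality): coefficients in columns 0 .. n-1, right-hand side in
   column n. *)
Definition output_lhs n s (a k : nat) (x : 'rV[R]_n) : R :=
  \sum_(j < n) cell s a k j * x ord0 j.

Definition output_set n s : set 'rV[R]_n :=
  [set x |
    (forall k, (k < ivar s 0)%N -> output_lhs s 1 k x = cell s 1 k n) /\
    (forall k, (k < ivar s 1)%N -> output_lhs s 2 k x <= cell s 2 k n)].

End Semantics.

(* Main.v *)
Require Import Defs.
From HB Require Import structures.
From mathcomp Require Import all_boot all_order all_algebra.
From mathcomp Require Import generic_quotient.
From mathcomp Require Import classical_sets reals.
From mathcomp Require Import zify ring lra.

Set Implicit Arguments.
Unset Strict Implicit.
Unset Printing Implicit Defensive.

Import Order.TTheory GRing.Theory Num.Theory.
Local Open Scope classical_set_scope.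
Local Open Scope quotient_scope.
Local Open Scope ring_scope.

(** Since dtr x y is the largest of the numbers (x_i - y_i) - (x_j - y_j), the
    cost of x is the least value of the sum of the d_nu^2 over all d such that
    (x_i - p_i) - (x_j - p_j) <= d_nu for every point p = p_nu and all i <> j.
    Finding the Frechet means is therefore a quadratic program in (x, d) with
    K = m N (N - 1) inequalities, N being the number of coordinates.  The
    objective is strictly convex in d, so all optimal points share the same d;
    call it d*.  The Frechet mean polytrope is the slice d = d* of the
    polyhedron (FM_polytope_fits), which is a system of K inequalities in x.
    So it suffices to compute one optimal point.

    For a set A of inequalities, let w_A minimize the objective on the affine
    subspace where the members of A hold with equality.  The best feasible
    point among the 2^K points w_A is optimal (feasible_face_minimizer): walk
    from a feasible point towards w_A, where A is the set of its tight
    inequalities.  By convexity the objective does not increase, and either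
    the walk reaches w_A or it is stopped by a new inequality, which can happen
    only finitely often.  This also shows that an optimum exists.

    To compute w_A, points are written (x, -1, d) in V = N + 1 + m homogeneous
    coordinates, so that inequalities are linear functionals, and a subspace is
    given by the rows of a matrix W: one row is a point, the others are
    directions.  A pivot on a functional a and a direction c subtracts from
    each row the multiple of c that makes a vanish on it.  Pivoting
    successively on the members of A parametrizes the subspace (parametrizes);
    pivoting then on the functionals z |-> <d-part of c, d-part of z>, for all
    directions c, is a Gram-Schmidt process (minimizing) after which the point
    row is w_A (minimizing_end).  An inconsistent A is harmless: its w_A is some
    point that passes or fails the feasibility test like any other.

    Each of the 2^K rounds costs polynomially many steps in V, at most V^6 in
    order of magnitude.  Diagonal pairs i = j are left out of the K
    inequalities, and this pays for the polynomial: V^6 <= C 2^V by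
    expn_le_exp2, and K + V <= m N^2 + N + 1.

    Programs are handled by a small logic: runs c s Q T says that c halts from
    s within T steps in a state satisfying Q, and everything that c does not
    touch is read off from its syntax (framed). *)

(** * Linear functionals and pivoting *)

Section LinearAlgebra.
Variables (R : realType) (V : nat).
Implicit Types (a w x y z t : 'rV[R]_V) (W : 'M[R]_V) (c b : 'I_V) (k : R).

Definition dot a z : R := (z *m a^T) ord0 ord0.

Lemma dotE a z : dot a z = \sum_l z ord0 l * a ord0 l.
Proof. by rewrite /dot mxE; apply: eq_bigr => l _; rewrite mxE. Qed.

Lemma dotC a z : dot a z = dot z a.
Proof. by rewrite !dotE; apply: eq_bigr => l _; rewrite mulrC. Qed.

Lemma dotD a y z : dot a (y + z) = dot a y + dot a z.
Proof. by rewrite /dot mulmxDl mxE. Qed.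

Lemma dotZ a k z : dot a (k *: z) = k * dot a z.
Proof. by rewrite /dot -scalemxAl mxE. Qed.

Lemma dotDl y z a : dot (y + z) a = dot y a + dot z a.
Proof. by rewrite dotC dotD ![dot a _]dotC. Qed.

Lemma dotZl k z a : dot (k *: z) a = k * dot z a.
Proof. by rewrite dotC dotZ dotC. Qed.

Lemma dotN a z : dot a (- z) = - dot a z.
Proof. by rewrite /dot mulNmx mxE. Qed.

Lemma dot_mulmx a t W : dot a (t *m W) = \sum_b t ord0 b * dot a (row b W).
Proof.
rewrite /dot -mulmxA mxE; apply: eq_bigr => b _; congr (_ * _).
by rewrite -row_mul [in RHS]mxE.
Qed.

(** Since 0^-1 = 0, the pivot is the identity when a vanishes on row c, so that
    the algorithm may attempt a pivot at every row. *)
Definition pivot a c W : 'M[R]_V :=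
  W - (dot a (row c W))^-1 *: (W *m a^T *m row c W).

(** The pivot commutes with taking the combination with coefficients t: this is
    why coefficients found before a sequence of pivots stay valid after it. *)
Lemma mul_pivot a c t W :
  t *m pivot a c W = t *m W - (dot a (t *m W) / dot a (row c W)) *: row c W.
Proof.
rewrite mulmxBr -scalemxAr !mulmxA [t *m W *m a^T]mx11_scalar mul_scalar_mx.
by rewrite scalerA [_^-1 * _]mulrC.
Qed.

Lemma row_pivot a c W b :
  row b (pivot a c W) =
  row b W - (dot a (row b W) / dot a (row c W)) *: row c W.
Proof. by rewrite !rowE mul_pivot -!rowE. Qed.

Lemma pivotE a c W b l :
  pivot a c W b l = W b l - dot a (row b W) / dot a (row c W) * W c l.
Proof. by have /rowP/(_ l) := row_pivot a c W b; rewrite !mxE. Qed.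

End LinearAlgebra.

(** * Quadratic programs by enumeration of faces *)

Section QuadraticProgram.
Variables (R : realType) (V : nat) (o : 'I_V) (D : pred 'I_V).
Implicit Types (a w x y z t : 'rV[R]_V) (W : 'M[R]_V) (c b : 'I_V) (k : R).
Implicit Types (S : seq 'rV[R]_V).

(** The objective only sees the coordinates in D; it is a degenerate quadratic
    form, whose polar form is dot (dpart y) z. *)
Definition dpart z : 'rV[R]_V := \row_l (if D l then z ord0 l else 0).

Definition sqnorm z : R := dot (dpart z) z.

Lemma sqnormE z : sqnorm z = \sum_(l | D l) z ord0 l ^+ 2.
Proof.
rewrite /sqnorm dotE [RHS]big_mkcond /=; apply: eq_bigr => l _; rewrite mxE.
by case: (D l); rewrite ?mulr0.
Qed.

Lemma sqnorm_ge0 z : 0 <= sqnorm z.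
Proof. by rewrite sqnormE sumr_ge0 // => l _; rewrite sqr_ge0. Qed.

Lemma sqnorm_eq0 z l : sqnorm z = 0 -> D l -> z ord0 l = 0.
Proof.
rewrite sqnormE => /eqP; rewrite psumr_eq0; last by move=> ? _; rewrite sqr_ge0.
by move=> /allP/(_ l); rewrite mem_index_enum sqrf_eq0 => /(_ isT)/implyP h /h/eqP.
Qed.

Lemma dot_dpartC y z : dot (dpart y) z = dot (dpart z) y.
Proof.
rewrite !dotE; apply: eq_bigr => l _; rewrite !mxE.
by case: (D l); rewrite ?mulr0 // mulrC.
Qed.

Lemma sqnorm_addZ y z k :
  sqnorm (y + k *: z) = sqnorm y + 2 * k * dot (dpart z) y + k ^+ 2 * sqnorm z.
Proof.
have e : dpart (y + k *: z) = dpart y + k *: dpart z.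
  by apply/rowP=> l; rewrite !mxE; case: (D l); rewrite // mulr0 addr0.
by rewrite /sqnorm e dotD dotZ !dotDl !dotZl (dot_dpartC y z); ring.
Qed.

Lemma sqnorm_convex y z k : 0 <= k <= 1 ->
  sqnorm (y + k *: (z - y)) <= sqnorm y + k * (sqnorm z - sqnorm y).
Proof.
move=> /andP[k0 k1].
have -> : sqnorm z = sqnorm (y + 1 *: (z - y)) by rewrite scale1r addrC subrK.
rewrite !sqnorm_addZ -subr_ge0; set u := sqnorm (z - y); set d := dot _ y.
have -> : sqnorm y + k * (sqnorm y + 2 * 1 * d + 1 ^+ 2 * u - sqnorm y) -
  (sqnorm y + 2 * k * d + k ^+ 2 * u) = k * (1 - k) * u by ring.
by rewrite !mulr_ge0 ?sqnorm_ge0 // subr_ge0.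
Qed.

(** The points of the affine space under study have coordinate -1 at o.  A
    normalized matrix stores one of them in row o and directions in the other
    rows, so the combinations with coefficient 1 at o are points again. *)
Definition normalized W := W o o = -1 /\ forall b, b != o -> W b o = 0.

Definition kills W a := forall b, b != o -> dot a (row b W) = 0.

Definition spans W z := exists t, t ord0 o = 1 /\ z = t *m W.

Lemma normalized_pivot a c W :
  c != o -> normalized W -> normalized (pivot a c W).
Proof.
move=> co [Wo W0]; split=> [|b bo]; rewrite pivotE (W0 c) // mulr0 subr0 //.
exact: W0.
Qed.

Lemma kills_pivot a' a c W : c != o -> kills W a' -> kills (pivot a c W) a'.
Proof.
move=> co h b bo.
by rewrite row_pivot -scaleNr dotD dotZ !h // mulr0 addr0.
Qed.

(** One successful pivot makes a vanish on all directions at once; the other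
    pivots of a sweep are then idle. *)
Lemma pivot_kills a c W : dot a (row c W) != 0 -> kills (pivot a c W) a.
Proof.
move=> n0 b bo.
by rewrite row_pivot -scaleNr dotD dotZ mulNr divfK // subrr.
Qed.

Lemma pivot0 a c W : dot a (row c W) = 0 -> pivot a c W = W.
Proof. by move=> e; rewrite /pivot e invr0 scale0r subr0. Qed.

(** The coefficients of z do not change: the correction in mul_pivot is a
    multiple of dot a z. *)
Lemma spans_pivot a c W z : dot a z = 0 -> spans W z -> spans (pivot a c W) z.
Proof.
move=> az [t [to e]]; exists t; split=> //.
by rewrite mul_pivot -e az mul0r scale0r subr0.
Qed.

(** W parametrizes the solutions of dot a z = 0 for a in S, if there are any.
    In the inconsistent case the last clause is empty, and row o is an
    arbitrary point. *)
Definition parametrizes S W :=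
  [/\ normalized W, {in S, forall a, kills W a} &
      forall z, z ord0 o = -1 -> {in S, forall a, dot a z = 0} -> spans W z].

Definition start : 'M[R]_V :=
  \matrix_(b, l) (if b == l then if b == o then -1 else 1 else 0).

Lemma parametrizes_start : parametrizes [::] start.
Proof.
split=> [|//|z zo _].
  by split=> [|b bo]; rewrite mxE ?eqxx // (negPf bo).
exists (\row_l (if l == o then 1 else z ord0 l)); split; first by rewrite mxE eqxx.
apply/rowP=> l; rewrite mxE (bigD1 l) //= big1 ?addr0 => [|b bl].
  by rewrite !mxE eqxx; case: eqP => [->|_]; rewrite ?mul1r ?mulr1.
by rewrite !mxE (negPf bl) mulr0.
Qed.

(** The rows before k have been tried as pivots for a.  A row on which a was
    found to vanish stays so: a later pivot is idle, or it makes a vanish on all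
    directions. *)
Definition sweeping S a (k : nat) W :=
  [/\ normalized W, {in S, forall a, kills W a},
      forall b, (b < k)%N -> b != o -> dot a (row b W) = 0 &
      forall z, z ord0 o = -1 -> {in a :: S, forall a, dot a z = 0} -> spans W z].

Lemma sweeping0 S a W : parametrizes S W -> sweeping S a 0 W.
Proof.
case=> nW kW sW; split=> // z zo h; apply: sW => // a' a'S.
by apply: h; rewrite inE a'S orbT.
Qed.

Lemma sweeping_pivot S a c W :
  c != o -> sweeping S a c W -> sweeping S a c.+1 (pivot a c W).
Proof.
move=> co [nW kW zW sW]; split.
- exact: normalized_pivot.
- by move=> a' a'S; apply: kills_pivot => //; apply: kW.
- move=> b; rewrite ltnS leq_eqVlt => bc bo.
  have [ac|ac] := eqVneq (dot a (row c W)) 0; last exact: pivot_kills.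
  rewrite pivot0 //; case/orP: bc => [/eqP/val_inj->//|bc]; exact: zW.
- move=> z zo h; apply: spans_pivot; last exact: sW.
  by apply: h; rewrite inE eqxx.
Qed.

Lemma sweeping_skip S a W : sweeping S a o W -> sweeping S a o.+1 W.
Proof.
case=> nW kW zW sW; split=> // b; rewrite ltnS leq_eqVlt => /orP[/eqP/val_inj->|].
  by rewrite eqxx.
exact: zW.
Qed.

Lemma sweeping_end S a W : sweeping S a V W -> parametrizes (a :: S) W.
Proof.
case=> nW kW zW sW; split=> // a'; rewrite inE => /predU1P[-> b|/kW//].
exact: zW.
Qed.

(** The state of the Gram-Schmidt process after the rows b < k.  A processed
    direction has no D-part left: if its D-part was nonzero, then the pivot at
    that row has replaced the direction by 0. The points that are kept need not
    include every solution z, only one that is at least as good. *)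
Definition minimizing S (k : nat) W :=
  [/\ normalized W, {in S, forall a, kills W a},
      forall b l, (b < k)%N -> b != o -> D l -> W b l = 0 &
      forall z, z ord0 o = -1 -> {in S, forall a, dot a z = 0} ->
        exists w,
          [/\ spans W w, {in S, forall a, dot a w = 0} & sqnorm w <= sqnorm z]].

Lemma minimizing0 S W : parametrizes S W -> minimizing S 0 W.
Proof. by case=> nW kW sW; split=> // z zo h; exists z; split=> //; apply: sW. Qed.

(** A point w of the current parametrization is replaced by its projection
    orthogonal, in the D-coordinates, to row c: the objective decreases by
    dot (dpart (row c W)) w ^+ 2 / sqnorm (row c W). *)
Lemma minimizing_pivot S c W : c != o ->
  minimizing S c W -> minimizing S c.+1 (pivot (dpart (row c W)) c W).
Proof.
move=> co [nW kW zW sW]; split.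
- exact: normalized_pivot.
- by move=> a aS; apply: kills_pivot => //; apply: kW.
- move=> b l; rewrite ltnS leq_eqVlt pivotE => /orP[/eqP/val_inj->|bc] bo Dl.
    have [q0|q0] := eqVneq (sqnorm (row c W)) 0; last first.
      by rewrite divff // mul1r subrr.
    by have := sqnorm_eq0 q0 Dl; rewrite mxE => ->; rewrite mulr0 subr0.
  rewrite zW // dot_dpartC dotE big1 ?mul0r ?subr0 // => l' _.
  by rewrite !mxE; case: ifP => [/(zW b l' bc bo)->|]; rewrite mulr0.
- move=> z zo h; have [w [[t [to e]] hw qw]] := sW z zo h.
  exists (t *m pivot (dpart (row c W)) c W); split.
  + by exists t.
  + move=> a aS; rewrite mul_pivot -scaleNr dotD dotZ -e (hw a aS) (kW a aS) //.
    by rewrite mulr0 addr0.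
  + apply: le_trans qw; rewrite mul_pivot -scaleNr -e sqnorm_addZ.
    rewrite -/(sqnorm (row c W)); set d := dot _ w; set u := sqnorm (row c W).
    have [->|u0] := eqVneq u 0; first by rewrite invr0; lra.
    have : 0 <= d ^+ 2 / u by rewrite divr_ge0 ?sqr_ge0 ?sqnorm_ge0.
    have -> : sqnorm w + 2 * - (d / u) * d + (- (d / u)) ^+ 2 * u =
        sqnorm w - d ^+ 2 / u by field.
    lra.
Qed.

Lemma minimizing_skip S W : minimizing S o W -> minimizing S o.+1 W.
Proof.
case=> nW kW zW sW; split=> // b l; rewrite ltnS leq_eqVlt.
by case/orP=> [/eqP/val_inj->|]; [rewrite eqxx | exact: zW].
Qed.

(** An inconsistent S leaves only the normalization of w. *)
Definition is_minimizer S w := w ord0 o = -1 /\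
  forall z, z ord0 o = -1 -> {in S, forall a, dot a z = 0} ->
    {in S, forall a, dot a w = 0} /\ sqnorm w <= sqnorm z.

(** At the end all directions are invisible to the objective and to S, so row o
    is as good as any other point of the parametrization. *)
Lemma minimizing_end S W : minimizing S V W -> is_minimizer S (row o W).
Proof.
case=> -[Wo _] kW zW sW; split=> [|z zo hz]; first by rewrite mxE.
have [w [[t [to e]] hw qw]] := sW z zo hz; split.
- move=> a aS; rewrite -(hw a aS) e dot_mulmx (bigD1 o) //= to mul1r big1 ?addr0 //.
  by move=> b bo; rewrite kW // mulr0.
- apply: le_trans qw; rewrite !sqnormE le_eqVlt; apply/orP; left; apply/eqP.
  apply: eq_bigr => l Dl; rewrite e !mxE (bigD1 o) //= to mul1r.
  rewrite big1 ?addr0 // => b bo; by rewrite zW // mulr0.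
Qed.

Definition feasible S z := z ord0 o = -1 /\ {in S, forall a, dot a z <= 0}.

(** The walk towards the minimizer of the current face, by induction on the
    number of inequalities that are not tight at z.  Stopping at the first
    inequality that would be violated keeps the tight ones tight and adds
    one. *)
Lemma feasible_face_minimizer S (Cand : 'rV[R]_V -> Prop) :
  (forall act : pred 'rV[R]_V,
     exists w, Cand w /\ is_minimizer [seq a <- S | act a] w) ->
  forall z, feasible S z ->
    exists w, [/\ Cand w, feasible S w & sqnorm w <= sqnorm z].
Proof.
move=> HC z; have [j le_j] := ubnP (count (fun a => dot a z != 0) S).
elim: j => // j IH in z le_j *; case=> zo hz.
have [w [Cw [wo mw]]] := HC (fun a => dot a z == 0).
have hz0 : {in [seq a <- S | dot a z == 0], forall a, dot a z = 0}.
  by move=> a; rewrite mem_filter => /andP[/eqP].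
have {mw}[hw qw] := mw z zo hz0.
have [/allP fw|] := boolP (all (fun a => dot a w <= 0) S); first by exists w.
case/allPn=> a0 a0S a0w.
pose bad (i : 'I_(size S)) := 0 < dot (nth 0 S i) w.
pose ratio (i : 'I_(size S)) :=
  dot (nth 0 S i) z / (dot (nth 0 S i) z - dot (nth 0 S i) w).
have i0P : (index a0 S < size S)%N by rewrite index_mem.
have bad0 : bad (Ordinal i0P) by rewrite /bad /= nth_index // ltNge.
have [i bi mi] := @arg_minP _ _ _ (Ordinal i0P) bad ratio bad0.
have badz a : a \in S -> 0 < dot a w -> dot a z < 0.
  move=> aS aw; rewrite lt_neqAle hz // andbT; apply/eqP => az.
  by move: aw; rewrite hw ?ltxx // mem_filter az eqxx.
(* k is the time at which the first inequality becomes tight on the segment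
   from z to w. *)
set k := ratio i in mi.
pose ai := nth 0 S i; have aiS : ai \in S by rewrite mem_nth.
have zi := badz _ aiS bi.
have ki : k * (dot ai z - dot ai w) = dot ai z.
  by rewrite /k /ratio -/ai divfK //; rewrite /bad -/ai in bi; lra.
have k01 : 0 <= k <= 1.
  by rewrite /bad -/ai in bi; apply/andP; split; nra.
have kP a : dot a (z + k *: (w - z)) = dot a z + k * (dot a w - dot a z).
  by rewrite dotD dotZ dotD dotN.
have [||w' [Cw' fw' qw']] := IH (z + k *: (w - z)).
- rewrite -ltnS; apply: leq_trans le_j; rewrite ltnS.
  rewrite -!size_filter; set P' := (fun a => _ != 0); set P := (fun a => _ != 0).
  have sub : {in S, forall a, P' a -> P a}.
    move=> a aS; apply: contraNN => /eqP az; rewrite kP az hw; last first.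
      by rewrite mem_filter az eqxx.
    by rewrite subrr mulr0 addr0.
  have -> : [seq a <- S | P' a] = [seq a <- [seq a <- S | P a] | P' a].
    rewrite -filter_predI; apply: eq_in_filter => a aS /=.
    by apply/idP/andP=> [h|[]//]; split=> //; apply: sub.
  rewrite [ltnLHS]size_filter -(count_predC P' [seq a <- S | P a]).
  rewrite -[ltnLHS]addn0 ltn_add2l -has_count; apply/hasP; exists ai.
    by rewrite mem_filter aiS /P lt_eqF.
  by rewrite /P' /= kP negbK; apply/eqP; lra.
- split; first by rewrite !mxE zo wo subrr mulr0 addr0.
  move=> a aS; rewrite kP; have az := hz a aS.
  have [aw|aw] := leP (dot a w) 0; first by case/andP: k01 => *; nra.
  have az' := badz a aS aw.
  have iaP : (index a S < size S)%N by rewrite index_mem.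
  have /mi : bad (Ordinal iaP).
    by rewrite /bad /= nth_index.
  rewrite /ratio /= nth_index // ler_ndivlMr; lra.
- exists w'; split=> //; apply: le_trans qw' _.
  apply: le_trans (sqnorm_convex _ _ k01) _.
  by case/andP: k01 => *; nra.
Qed.

End QuadraticProgram.

(** * Frechet means as a quadratic program *)

Section TropicalFits.
Variables (R : realType) (n m : nat) (p : 'I_m -> 'rV[R]_n.+1).
Implicit Types (x y : 'rV[R]_n.+1) (d e : 'I_m -> R).

Lemma vec_dtr_ge x y i j :
  (x ord0 i - y ord0 i) - (x ord0 j - y ord0 j) <= vec_dtr x y.
Proof.
rewrite /vec_dtr lerB //.
  by apply: le_trans (le_bigmax _ _ i); rewrite !mxE.
by apply: le_trans (bigmin_le _ j _) _; rewrite !mxE.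
Qed.

Lemma vec_dtr_attained x y :
  exists i j, vec_dtr x y = (x ord0 i - y ord0 i) - (x ord0 j - y ord0 j).
Proof.
have [i ei] : exists i, coord_max (x - y) = (x - y) ord0 i.
  rewrite /coord_max.
  elim/big_ind: _ => [|_ _ [i ->] [j ->]|i _]; [by exists ord0| |by exists i].
  by case: (leP ((x - y) ord0 i) ((x - y) ord0 j)); [exists j | exists i].
have [j ej] : exists j, coord_min (x - y) = (x - y) ord0 j.
  rewrite /coord_min.
  elim/big_ind: _ => [|_ _ [i' ->] [j ->]|j _]; [by exists ord0| |by exists j].
  by case: (leP ((x - y) ord0 i') ((x - y) ord0 j)); [exists i' | exists j].
by exists i, j; rewrite /vec_dtr ei ej !mxE.
Qed.

Definition fits x d := forall nu i j, i != j ->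
  (x ord0 i - p nu ord0 i) - (x ord0 j - p nu ord0 j) <= d nu.

Lemma fits_dtr x : fits x (fun nu => vec_dtr x (p nu)).
Proof. by move=> nu i j _; apply: vec_dtr_ge. Qed.

(** If the distance is attained at i <> j, then it is bounded by d nu; otherwise
    it is 0.  Squares are compared because d nu may be negative when n = 0. *)
Lemma fits_dtr_sqr x d nu : fits x d -> vec_dtr x (p nu) ^+ 2 <= d nu ^+ 2.
Proof.
move=> fxd; have [i [j e]] := vec_dtr_attained x (p nu).
have [eij|ij] := eqVneq i j; first by rewrite e eij subrr expr0n sqr_ge0.
have := fxd nu i j ij; rewrite -e => le_d.
have d0 : 0 <= vec_dtr x (p nu).
  by apply: le_trans (vec_dtr_ge _ _ i i); rewrite subrr.
by rewrite ler_sqr ?nnegrE // (le_trans d0).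
Qed.

Lemma frechet_cost_pi x :
  frechet_cost (fun nu => \pi_(torus R n) (p nu)) (\pi_(torus R n) x) =
  \sum_nu vec_dtr x (p nu) ^+ 2.
Proof. by apply: eq_bigr => nu _; rewrite dtr_pi. Qed.

(** If x is a Frechet mean with distances e, then (x, e) is optimal, like (x0, d)
    for any x0 that fits d, and so is their midpoint; by the parallelogram
    identity d = e. *)
Lemma FM_polytope_fits d :
  (exists x, fits x d) ->
  (forall y e, fits y e -> \sum_nu d nu ^+ 2 <= \sum_nu e nu ^+ 2) ->
  forall x, fits x d <->
    FM_polytope (fun nu => \pi_(torus R n) (p nu)) (\pi_(torus R n) x).
Proof.
move=> [x0 fx0] opt x; split=> [fx v|FMx].
  rewrite -[v]reprK !frechet_cost_pi.
  apply: (@le_trans _ _ (\sum_nu d nu ^+ 2)).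
    by apply: ler_sum => nu _; apply: fits_dtr_sqr.
  by apply: opt; apply: fits_dtr.
pose e nu := vec_dtr x (p nu).
have fxe : fits x e by apply: fits_dtr.
have le_ed : \sum_nu e nu ^+ 2 <= \sum_nu d nu ^+ 2.
  have := FMx (\pi_(torus R n) x0); rewrite !frechet_cost_pi => /le_trans; apply.
  by apply: ler_sum => nu _; apply: fits_dtr_sqr.
pose h nu := (d nu + e nu) / 2.
have /opt le_dh : fits (2^-1 *: (x0 + x)) h.
  move=> nu i j ij; rewrite !mxE /h.
  by have := fx0 nu i j ij; have := fxe nu i j ij; lra.
have s0 : \sum_nu (d nu - e nu) ^+ 2 <= 0.
  have -> : \sum_nu (d nu - e nu) ^+ 2 =
    2 * (\sum_nu d nu ^+ 2 + \sum_nu e nu ^+ 2) - 4 * \sum_nu h nu ^+ 2.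
    rewrite -big_split /= !mulr_sumr -sumrB; apply: eq_bigr => nu _.
    by rewrite /h; field.
  lra.
have de nu : d nu = e nu.
  have : \sum_nu (d nu - e nu) ^+ 2 == 0.
    by rewrite eq_le s0 sumr_ge0 // => ? _; rewrite sqr_ge0.
  rewrite psumr_eq0 => [/allP/(_ nu)|? _]; last by rewrite sqr_ge0.
  by rewrite mem_index_enum sqrf_eq0 subr_eq0 => /(_ isT)/implyP/(_ isT)/eqP.
by move=> nu i j ij; rewrite de; apply: fxe.
Qed.

End TropicalFits.

Section Encoding.
Variables (R : realType) (n m : nat).
Local Notation N := n.+1.
Local Notation V := (N.+1 + m)%N.

(** A point (x, -1, d) has x in coordinates 0 .. n, the homogenizing -1 in
    coordinate N, and d in the last m ones.  Putting the constant in
    coordinate N leaves each inequality laid out as the output requires, once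
    the d-part has been moved to the right-hand side. *)
Definition vec (f : nat -> R) : 'rV[R]_V := \row_l f l.

Lemma eq_vec f g : (forall l, (l < V)%N -> f l = g l) -> vec f = vec g.
Proof. by move=> e; apply/rowP=> l; rewrite !mxE e. Qed.

Lemma hom_subproof : (N < V)%N. Proof. by rewrite leq_addr. Qed.
Definition hom : 'I_V := Ordinal hom_subproof.

Definition dcoord : pred 'I_V := fun l => (N < l)%N.

Definition d_of (z : 'rV[R]_V) (nu : 'I_m) : R := z ord0 (rshift N.+1 nu).
Definition x_of (z : 'rV[R]_V) : 'rV[R]_N :=
  \row_i z ord0 (lshift m (widen_ord (leqnSn N) i)).

Lemma sum_coord (F : 'I_V -> R) :
  \sum_l F l = \sum_i F (lshift m (widen_ord (leqnSn N) i)) + F hom +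
    \sum_nu F (rshift N.+1 nu).
Proof.
rewrite big_split_ord /= big_ord_recr /=; congr (_ + F _ + _).
exact: val_inj.
Qed.

Lemma sqnorm_sum z : sqnorm dcoord z = \sum_nu d_of z nu ^+ 2.
Proof.
rewrite sqnormE big_mkcond sum_coord /= big1 ?add0r => [|i _]; last first.
  by rewrite /dcoord /= ltnNge ltnW ?ltn_ord.
rewrite {1}/dcoord /= ltnn add0r; apply: eq_bigr => nu _.
by rewrite /dcoord /= leq_addr.
Qed.

Definition point (x : 'rV[R]_N) (d : 'I_m -> R) : 'rV[R]_V :=
  \row_l match split l with
         | inl l' => if unlift ord_max l' is Some i then x ord0 i else -1
         | inr nu => d nu
         end.

Lemma widen_max (i : 'I_N) : widen_ord (leqnSn N) i = lift ord_max i.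
Proof. by apply: val_inj; rewrite /= /bump leqNgt ltn_ord. Qed.

Lemma x_of_point x d : x_of (point x d) = x.
Proof.
apply/rowP=> i; rewrite !mxE; have := unsplitK (inl (widen_ord (leqnSn N) i)).
by move=> /= ->; rewrite widen_max liftK.
Qed.

Lemma d_of_point x d nu : d_of (point x d) nu = d nu.
Proof. by rewrite /d_of mxE; have := unsplitK (inr nu) => /= ->. Qed.

Lemma point_hom x d : point x d ord0 hom = -1.
Proof.
rewrite mxE; have -> : hom = lshift m ord_max by apply: val_inj.
by have := unsplitK (inl ord_max) => /= ->; rewrite unlift_none.
Qed.

(** The functional x_i - x_j - (p_i - p_j) - d_nu on points, for the index
    (nu, i, j); the tests come in the reverse of the order in which the
    program writes the entries. *)
Definition coef (pt : nat -> nat -> R) (c : nat * nat * nat) (l : nat) : R :=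
  let: (nu, i, j) := c in
  if l == (N + 1 + nu)%N then -1
  else if l == N then pt nu i - pt nu j
  else if l == j then -1
  else if l == i then 1 else 0.

Lemma sum_delta (k : nat) (F : 'I_k -> R) (i : 'I_k) :
  \sum_l F l * (l == i)%:R = F i.
Proof.
rewrite (bigD1 i) //= eqxx mulr1 big1 ?addr0 // => l li.
by rewrite (negPf li) mulr0.
Qed.

Lemma dot_coef pt (nu : 'I_m) (i j : 'I_N) z : i != j ->
  dot (vec (coef pt (nu : nat, i : nat, j : nat))) z =
  x_of z ord0 i - x_of z ord0 j + (pt nu i - pt nu j) * z ord0 hom - d_of z nu.
Proof.
move=> ij; rewrite dotE sum_coord.
under eq_bigr => i' _.
  have lN := ltn_ord i'.
  have -> : vec (coef pt (nu : nat, i : nat, j : nat)) ord0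
              (lshift m (widen_ord (leqnSn N) i')) =
            (i' == i)%:R - (i' == j)%:R.
    rewrite mxE /= (_ : (i' == N + 1 + nu :> nat) = false)%N; last by lia.
    rewrite (_ : (i' == N :> nat) = false); last by lia.
    rewrite -!val_eqE /=.
    have [->|_] := eqVneq (i' : nat) j; last by case: eqP; rewrite subr0.
    by rewrite eq_sym val_eqE (negPf ij) sub0r.
  rewrite mulrBr; over.
rewrite sumrB !sum_delta.
under [X in _ + X]eq_bigr => nu' _.
  have -> : vec (coef pt (nu : nat, i : nat, j : nat)) ord0 (rshift N.+1 nu') =
            - (nu' == nu)%:R.
    rewrite mxE /= !addn1 eqn_add2l val_eqE; case: eqP => // _.
    have := ltn_ord i; have := ltn_ord j => hj hi.
    by rewrite !gtn_eqF ?oppr0 //; lia.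
  rewrite mulrN; over.
rewrite sumrN sum_delta !mxE /= eqxx ltn_eqF; last by rewrite addn1 ltnS leq_addr.
by rewrite /d_of mulrC.
Qed.

Variable p : 'I_m -> 'rV[R]_N.
Variable pt : nat -> nat -> R.
Hypothesis ptE : forall (nu : 'I_m) (i : 'I_N), pt nu i = p nu ord0 i.

(** The indices in the order in which three nested loops produce them; the
    bound k of each level is the loop counter. *)
Definition indices_j nu i k : seq (nat * nat * nat) :=
  [seq (nu, i, j) | j <- iota 0 k & j != i].
Definition indices_i nu k := flatten [seq indices_j nu i N | i <- iota 0 k].
Definition indices_nu k := flatten [seq indices_i nu N | nu <- iota 0 k].
Definition indices := indices_nu m.

Lemma mem_indices nu i j : ((nu, i, j) \in indices) =
  [&& (nu < m)%N, (i < N)%N, (j < N)%N & i != j].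
Proof.
apply/flatten_mapP/and4P => [[nu' + /flatten_mapP[i' + /mapP[j' + [-> -> ->]]]]|].
  by rewrite mem_filter !mem_iota /= !add0n => -> -> /andP[ij ->]; rewrite eq_sym.
move=> [h1 h2 h3 h4]; exists nu; first by rewrite mem_iota.
apply/flatten_mapP; exists i; first by rewrite mem_iota.
by apply/mapP; exists j; rewrite // mem_filter mem_iota eq_sym h4.
Qed.

Lemma size_flatten_map (F : nat -> seq (nat * nat * nat)) k b :
  (forall i, (i < k)%N -> size (F i) = b) ->
  size (flatten [seq F i | i <- iota 0 k]) = (k * b)%N.
Proof.
move=> e; rewrite size_flatten /shape -map_comp sumnE big_map.
rewrite (eq_big_seq (fun _ => b)) => [|i]; last by rewrite mem_iota; apply: e.
by rewrite big_const_seq count_predT size_iota iter_addn_0 mulnC.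
Qed.

Lemma size_indices : size indices = (m * (N * n))%N.
Proof.
apply: size_flatten_map => nu _; apply: size_flatten_map => i iN.
rewrite size_map size_filter; have := count_predC (pred1 i) (iota 0 N).
by rewrite size_iota count_uniq_mem ?iota_uniq // mem_iota /= add0n iN => -[].
Qed.

Definition rows := [seq vec (coef pt c) | c <- indices].

Lemma feasible_fits z :
  feasible hom rows z <-> z ord0 hom = -1 /\ fits p (x_of z) (d_of z).
Proof.
split=> -[zo h]; split=> //.
  move=> nu i j ij; have /h : vec (coef pt (nu : nat, i : nat, j : nat)) \in rows.
    by apply: map_f; rewrite mem_indices !ltn_ord.
  by rewrite dot_coef // zo !ptE; lra.
move=> _ /mapP[[[nu i] j] + ->]; rewrite mem_indices => /and4P[h1 h2 h3 ij].
have := h (Ordinal h1) (Ordinal h2) (Ordinal h3) ij.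
rewrite (@dot_coef _ (Ordinal h1) (Ordinal h2) (Ordinal h3)) // zo.
by rewrite -!ptE /=; lra.
Qed.

Lemma FM_polytope_minimizer w :
  feasible hom rows w ->
  (forall z, feasible hom rows z -> sqnorm dcoord w <= sqnorm dcoord z) ->
  forall x, feasible hom rows (point x (d_of w)) <->
    FM_polytope (fun nu => \pi_(torus R n) (p nu)) (\pi_(torus R n) x).
Proof.
move=> /feasible_fits[wo fw] opt x; rewrite feasible_fits x_of_point point_hom.
have d_ofE y d : fits p y (d_of (point y d)) <-> fits p y d.
  by split=> h nu i j ij; have := h nu i j ij; rewrite d_of_point.
rewrite d_ofE -(@FM_polytope_fits _ _ _ _ (d_of w)); first by split=> [[]|].
- by exists (x_of w).
- move=> y e fye; have := opt (point y e); rewrite !sqnorm_sum.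
  under [X in _ <= X]eq_bigr do rewrite d_of_point.
  by apply; apply/feasible_fits; rewrite x_of_point point_hom d_ofE.
Qed.

End Encoding.

(** * A program logic that counts steps *)

Definition For (x b : nat) (body : cmd) : cmd :=
  Seq (ISet x (IConst 0))
      (While (Not (ILe (IVar b) (IVar x)))
             (Seq body (ISet x (IAdd (IVar x) (IConst 1))))).

Definition IfEq (x y : nat) (c d : cmd) : cmd :=
  If (ILe (IVar x) (IVar y)) (If (ILe (IVar y) (IVar x)) c d) d.

Fixpoint ivars_of (c : cmd) : seq nat :=
  match c with
  | ISet x _ => [:: x]
  | Skip | RSet _ _ _ _ | RDiv _ _ _ _ _ => [::]
  | Seq c d | If _ c d => ivars_of c ++ ivars_of d
  | While _ c => ivars_of c
  end.

Fixpoint arrays_of (c : cmd) : seq nat :=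
  match c with
  | RSet a _ _ _ | RDiv a _ _ _ _ => [:: a]
  | Skip | ISet _ _ => [::]
  | Seq c d | If _ c d => arrays_of c ++ arrays_of d
  | While _ c => arrays_of c
  end.

Section ProgramLogic.
Variable R : realType.
Implicit Types (s : state R) (Q : state R -> Prop).

Definition framed (c : cmd) s s' :=
  (forall x, x \notin ivars_of c -> ivar s' x = ivar s x) /\
  (forall a, a \notin arrays_of c -> forall i j, cell s' a i j = cell s a i j).

Lemma exec_framed c s s' t : exec c s s' t -> framed c s s'.
Proof.
elim=> {c s s' t} /=; try by [].
- by move=> s x e; split=> //= y; rewrite inE => /negPf->.
- by move=> s a i j e; split=> //= a'; rewrite inE => /negPf-> .
- by move=> s a i j e f _; split=> //= a'; rewrite inE => /negPf-> .
- move=> s s' s'' c d t u _ [i1 a1] _ [i2 a2]; split=> [x|a].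
    by rewrite mem_cat => /norP[? ?]; rewrite i2 // i1.
  by rewrite mem_cat => /norP[? ?] i j; rewrite a2 // a1.
- move=> s s' b c d t _ _ [i1 a1]; split=> [x|a].
    by rewrite mem_cat => /norP[? ?]; rewrite i1.
  by rewrite mem_cat => /norP[? ?] i j; rewrite a1.
- move=> s s' b c d t _ _ [i1 a1]; split=> [x|a].
    by rewrite mem_cat => /norP[? ?]; rewrite i1.
  by rewrite mem_cat => /norP[? ?] i j; rewrite a1.
- move=> s s' s'' b c t u _ _ [i1 a1] _ [i2 a2]; split=> [x|a] h.
    by rewrite i2 // i1.
  by move=> i j; rewrite a2 // a1.
Qed.

Definition runs (c : cmd) s Q (T : nat) :=
  exists s' t, [/\ exec c s s' t, Q s' & (t <= T)%N].

Lemma runs_le c s Q T T' : runs c s Q T -> (T <= T')%N -> runs c s Q T'.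
Proof. by move=> [s' [t [e h l]]] l'; exists s', t; split=> //; apply: leq_trans l'. Qed.

Lemma runs_post c s Q Q' T : runs c s Q T ->
  (forall s', framed c s s' -> Q s' -> Q' s') -> runs c s Q' T.
Proof.
move=> [s' [t [e h l]]] H; exists s', t; split=> //; apply: H => //.
exact: exec_framed e.
Qed.

Lemma runs_skip s Q : Q s -> runs Skip s Q 1.
Proof. by exists s, 1%N; split=> //; constructor. Qed.

Lemma runs_iset x e s Q :
  Q (set_ivar s x (ieval s e)) -> runs (ISet x e) s Q (icost e).+1.
Proof. by move=> h; do 2 eexists; split; [constructor|exact: h|]. Qed.

Lemma runs_rset a i j e s Q :
  Q (set_cell s a (ieval s i) (ieval s j) (reval s e)) ->
  runs (RSet a i j e) s Q (icost i + icost j + rcost e).+1.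
Proof. by move=> h; do 2 eexists; split; [constructor|exact: h|]. Qed.

Lemma runs_rdiv a i j e f s Q : reval s f != 0 ->
  Q (set_cell s a (ieval s i) (ieval s j) (reval s e / reval s f)) ->
  runs (RDiv a i j e f) s Q (icost i + icost j + rcost e + rcost f).+2.
Proof. by move=> f0 h; do 2 eexists; split; [constructor|exact: h|]. Qed.

(** The second command may use all that the syntax of the first one tells on
    the intermediate state, so Q1 only has to describe what has changed. *)
Lemma runs_seq c d s Q1 Q T1 T2 : runs c s Q1 T1 ->
  (forall s', framed c s s' -> Q1 s' -> runs d s' Q T2) ->
  runs (Seq c d) s Q (T1 + T2).
Proof.
move=> [s1 [t1 [e1 h1 l1]]] H.
have [s2 [t2 [e2 h2 l2]]] := H _ (exec_framed e1) h1.
by exists s2, (t1 + t2)%N; split=> //; [econstructor; eassumption | exact: leq_add].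
Qed.

Lemma runs_seq_iset x e d s Q T :
  runs d (set_ivar s x (ieval s e)) Q T ->
  runs (Seq (ISet x e) d) s Q ((icost e).+1 + T).
Proof.
move=> [s' [t [h q l]]]; do 2 eexists; split; [|exact: q|].
  by econstructor; [constructor | exact: h].
by rewrite leq_add2l.
Qed.

Lemma runs_seq_rset a i j e d s Q T :
  runs d (set_cell s a (ieval s i) (ieval s j) (reval s e)) Q T ->
  runs (Seq (RSet a i j e) d) s Q ((icost i + icost j + rcost e).+1 + T).
Proof.
move=> [s' [t [h q l]]]; do 2 eexists; split; [|exact: q|].
  by econstructor; [constructor | exact: h].
by rewrite leq_add2l.
Qed.

Lemma runs_if b c d s Q T1 T2 :
  (teval s b -> runs c s Q T1) -> (~~ teval s b -> runs d s Q T2) ->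
  runs (If b c d) s Q (tcost b + (T1 + T2)).
Proof.
move=> H1 H2; have [h|h] := boolP (teval s b).
  have [s' [t [e q l]]] := H1 h; exists s', (tcost b + t)%N; split=> //.
    exact: ExecIfTrue.
  by rewrite leq_add2l (leq_trans l) ?leq_addr.
have [s' [t [e q l]]] := H2 h; exists s', (tcost b + t)%N; split=> //.
  exact: ExecIfFalse.
by rewrite leq_add2l (leq_trans l) ?leq_addl.
Qed.

Lemma runs_ifeq x y c d s Q T1 T2 :
  (ivar s x = ivar s y -> runs c s Q T1) ->
  (ivar s x <> ivar s y -> runs d s Q T2) ->
  runs (IfEq x y c d) s Q (6 + (T1 + T2)).
Proof.
move=> H1 H2.
have [e|/eqP ne] := eqVneq (ivar s x) (ivar s y).
  have [s' [t [h q l]]] := H1 e; do 2 eexists; split; [|exact: q|].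
    by apply: ExecIfTrue; last apply: ExecIfTrue; rewrite /= ?e //; exact: h.
  by rewrite /= addnA leq_add2l (leq_trans l) ?leq_addr.
have [s' [t [h q l]]] := H2 ne.
have [le|le] := boolP (teval s (ILe (IVar x) (IVar y))).
  do 2 eexists; split; [|exact: q|].
    apply: ExecIfTrue => //; apply: ExecIfFalse; last exact: h.
    by rewrite /= in le *; lia.
  by rewrite /= addnA leq_add2l (leq_trans l) ?leq_addl.
do 2 eexists; split; [|exact: q|].
  by apply: ExecIfFalse => //; exact: h.
by rewrite /=; lia.
Qed.

(** The invariant is asked for after the counter has been advanced; for an
    invariant that does not mention the counter x, the two set_ivar vanish by
    computation.  The step count is 2 + 4 for entering and leaving the loop and
    8 for the test and the increment of each round. *)
Lemma runs_for (Inv : nat -> state R -> Prop) n x b body s Q T :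
  ivar s b = n -> b \notin x :: ivars_of body -> x \notin ivars_of body ->
  Inv 0%N (set_ivar s x 0) ->
  (forall k s', (k < n)%N -> ivar s' x = k -> framed (For x b body) s s' ->
     Inv k s' -> runs body s' (fun s'' => Inv k.+1 (set_ivar s'' x k.+1)) T) ->
  (forall s', framed (For x b body) s s' -> Inv n s' -> Q s') ->
  runs (For x b body) s Q (6 + n * (T + 8)).
Proof.
move=> sb; rewrite inE negb_or => /andP[bx bbody] xbody inv0 step post.
pose loop := While (Not (ILe (IVar b) (IVar x)))
             (Seq body (ISet x (IAdd (IVar x) (IConst 1)))).
have main j : forall k s', (k + j = n)%N -> ivar s' x = k -> ivar s' b = n ->
    framed (For x b body) s s' -> Inv k s' ->
    exists s'' t, [/\ exec loop s' s'' t, Inv n s'' & (t <= 4 + j * (T + 8))%N].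
  elim: j => [|j IH] k s' kj xk bn fr inv.
    exists s', 4%N; split=> //.
      by apply: ExecWhileFalse; rewrite /= xk bn; lia.
    by rewrite -kj addn0.
  have [|s1 [t1 [e1 h1 l1]]] := step k s' _ xk fr inv; first by lia.
  have [fi1 fa1] := exec_framed e1.
  have e1' : exec (Seq body (ISet x (IAdd (IVar x) (IConst 1)))) s'
      (set_ivar s1 x k.+1) (t1 + 4).
    apply: ExecSeq e1 _.
    have := ExecISet s1 x (IAdd (IVar x) (IConst 1)).
    by rewrite /= fi1 // xk addn1.
  have [|||||s2 [t2 [e2 h2 l2]]] := IH k.+1 (set_ivar s1 x k.+1).
  - by lia.
  - by rewrite /= eqxx.
  - by rewrite /= (negPf bx) fi1.
  - case: fr => fi fa; split=> [y|a] /=.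
      rewrite inE negb_or => /andP[/[dup] yx /negPf->]; rewrite mem_cat inE.
      by move=> /norP[yb _]; rewrite fi1 // fi // inE negb_or yx mem_cat inE negb_or yb.
    rewrite cats0 => ab i i'; rewrite fa1 // fa //.
    by rewrite /= cats0.
  - exact: h1.
  exists s2, (4 + (t1 + 4) + t2)%N; split=> //; last by nia.
  apply: (ExecWhileTrue (s' := set_ivar s1 x k.+1)) e2 => //.
  by rewrite /= xk bn; lia.
have [|||||s' [t [e h l]]] := main n 0%N (set_ivar s x 0) => //.
- by rewrite /= eqxx.
- by rewrite /= (negPf bx).
- by split=> //= y; rewrite inE negb_or => /andP[/negPf->].
have e' : exec (For x b body) s s' (2 + t).
  by apply: ExecSeq e; apply: (ExecISet s x (IConst 0)).
exists s', (2 + t)%N; split=> //.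
by apply: post => //; apply: exec_framed e'.
Qed.

End ProgramLogic.

(** * The program *)

Local Coercion IVar : nat >-> iexp.

(* Index variables: the dimensions m, N, V; the numbers K of inequalities and E
   of masks; counters; the outcome of the feasibility test; whether a feasible
   point has been found. *)
Local Notation i_m := 0%N (only parsing).
Local Notation i_N := 1%N (only parsing).
Local Notation i_V := 2%N (only parsing).
Local Notation i_K := 3%N (only parsing).
Local Notation i_E := 4%N (only parsing).
Local Notation i_nu := 5%N (only parsing).
Local Notation i_i := 6%N (only parsing).
Local Notation i_j := 7%N (only parsing).
Local Notation i_k := 8%N (only parsing).
Local Notation i_e := 9%N (only parsing).
Local Notation i_c := 10%N (only parsing).
Local Notation i_b := 11%N (only parsing).
Local Notation i_l := 12%N (only parsing).
Local Notation i_ok := 13%N (only parsing).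
Local Notation i_found := 14%N (only parsing).
(* Arrays: the input points; the inequalities, which become the output; the
   matrix W; the masks that enumerate the subsets; a copy of the pivot row; the
   current functional; scratch numbers; the best feasible point in row 0 and its
   cost in row 1. *)
Local Notation a_pts := 0%N (only parsing).
Local Notation a_rows := 2%N (only parsing).
Local Notation a_mat := 3%N (only parsing).
Local Notation a_mask := 4%N (only parsing).
Local Notation a_pivot := 5%N (only parsing).
Local Notation a_fun := 6%N (only parsing).
Local Notation a_sc := 7%N (only parsing).
Local Notation a_best := 8%N (only parsing).

Local Notation i0 := (IConst 0) (only parsing).
Local Notation i1 := (IConst 1) (only parsing).

Definition dot_vector (x d : nat) : cmd :=
  Seq (RSet a_sc i0 (IConst d) RZero)
      (For i_l i_V (RSet a_sc i0 (IConst d)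
         (RAdd (RCell a_sc i0 (IConst d))
               (RMul (RCell a_mat x i_l) (RCell a_fun i0 i_l))))).

(** The pivot row is copied first because it is itself among the rows to be
    updated.  The test r * r <= 0 decides r = 0, where the division would be
    stuck. *)
Definition pivot_vector : cmd :=
  Seq (dot_vector i_c 0)
  (If (RLe (RMul (RCell a_sc i0 i0) (RCell a_sc i0 i0)) RZero) Skip
  (Seq (For i_l i_V (RSet a_pivot i0 i_l (RCell a_mat i_c i_l)))
  (For i_b i_V
    (Seq (dot_vector i_b 1)
    (Seq (RDiv a_sc i0 i1 (RCell a_sc i0 i1) (RCell a_sc i0 i0))
    (For i_l i_V (RSet a_mat i_b i_l
       (RSub (RCell a_mat i_b i_l)
             (RMul (RCell a_sc i0 i1) (RCell a_pivot i0 i_l)))))))))).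

Definition reset : cmd :=
  Seq (For i_b i_V (Seq (For i_l i_V (RSet a_mat i_b i_l RZero))
                        (RSet a_mat i_b i_b ROne)))
      (RSet a_mat i_N i_N (RSub RZero ROne)).

Definition load_row : cmd :=
  For i_l i_V (RSet a_fun i0 i_l (RCell a_rows i_k i_l)).

Definition load_dpart (x : nat) : cmd :=
  Seq (For i_l i_V (RSet a_fun i0 i_l (RCell a_mat x i_l)))
  (Seq (For i_l i_N (RSet a_fun i0 i_l RZero))
       (RSet a_fun i0 i_N RZero)).

Definition sweep : cmd := For i_c i_V (IfEq i_c i_N Skip pivot_vector).

Definition eliminate : cmd :=
  For i_k i_K (If (RLe ROne (RCell a_mask i_e i_k)) (Seq load_row sweep) Skip).

Definition minimize : cmd :=
  For i_c i_V (IfEq i_c i_N Skip (Seq (load_dpart i_c) pivot_vector)).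

Definition check_feasible : cmd :=
  Seq (ISet i_ok i1)
  (For i_k i_K (Seq load_row (Seq (dot_vector i_N 0)
     (If (RLe (RCell a_sc i0 i0) RZero) Skip (ISet i_ok i0))))).

Definition save : cmd :=
  Seq (For i_l i_V (RSet a_best i0 i_l (RCell a_mat i_N i_l)))
  (Seq (RSet a_best i1 i0 (RCell a_sc i0 i0)) (ISet i_found i1)).

Definition compare : cmd :=
  Seq (load_dpart i_N) (Seq (dot_vector i_N 0)
  (If (ILe i_ok i0) Skip
  (If (ILe i_found i0) save
  (If (RLe (RCell a_best i1 i0) (RCell a_sc i0 i0)) Skip save)))).

Definition search : cmd :=
  For i_e i_E (Seq reset (Seq eliminate (Seq minimize
    (Seq check_feasible compare)))).

Definition add_row : cmd :=
  Seq (RSet a_rows i_K i_i ROne)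
  (Seq (RSet a_rows i_K i_j (RSub RZero ROne))
  (Seq (RSet a_rows i_K i_N (RSub (RCell a_pts i_nu i_i) (RCell a_pts i_nu i_j)))
  (Seq (RSet a_rows i_K (IAdd (IAdd i_N i1) i_nu) (RSub RZero ROne))
       (ISet i_K (IAdd i_K i1))))).

Definition build_rows : cmd :=
  For i_nu i_m (For i_i i_N (For i_j i_N (IfEq i_i i_j Skip add_row))).

(** The masks of k inequalities form a list of E = 2^k rows; it is doubled by
    appending a copy of each row with a 1 in the new column. *)
Definition build_masks : cmd :=
  Seq (ISet i_E i1)
  (For i_k i_K (Seq
     (For i_e i_E (Seq
        (For i_c i_k (RSet a_mask (IAdd i_E i_e) i_c (RCell a_mask i_e i_c)))
        (RSet a_mask (IAdd i_E i_e) i_k ROne)))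
     (ISet i_E (IAdd i_E i_E)))).

(** Replaces d by its optimal value in every inequality; the numbers of
    equations and inequalities are written last, over the variables that held
    m and N. *)
Definition finish : cmd :=
  Seq (For i_k i_K (For i_l i_m (RSet a_rows i_k i_N
     (RSub (RCell a_rows i_k i_N)
           (RMul (RCell a_rows i_k (IAdd (IAdd i_N i1) i_l))
                 (RCell a_best i0 (IAdd (IAdd i_N i1) i_l)))))))
  (Seq (ISet i_N i_K) (ISet i_m i0)).

Definition frechet_program : cmd :=
  Seq (ISet i_V (IAdd (IAdd i_N i1) i_m))
  (Seq build_rows (Seq build_masks (Seq search finish))).

(** * Correctness of the elimination *)

Section Correctness.
Variables (R : realType) (n m : nat).
Local Notation N := n.+1.
Local Notation V := (N.+1 + m)%N.
Local Notation hom := (hom n m).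
Local Notation dcoord := (@dcoord n m).
Implicit Types (s : state R).

Definition dims s := [/\ ivar s i_m = m, ivar s i_N = N & ivar s i_V = V].

Lemma dims_framed c s s' : framed c s s' ->
  all (fun x => x \notin ivars_of c) [:: i_m; i_N; i_V] -> dims s -> dims s'.
Proof. by move=> [fi _] /and4P[h1 h2 h3 _] [d1 d2 d3]; split; rewrite fi. Qed.

Definition mat s : 'M[R]_V := \matrix_(b, l) cell s a_mat b l.
Definition functional s : 'rV[R]_V := vec n m (cell s a_fun 0).
Definition row_of s k : 'rV[R]_V := vec n m (cell s a_rows k).

(** Filling an initial segment of row r of an array.  The entry may depend on
    anything that such a loop leaves alone, including the entries of the row
    that it has not reached yet. *)
Lemma runs_fill (a x b : nat) i e s k (r : nat) f :
  ivar s b = k -> b != x ->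
  (forall j s', (j < k)%N -> ivar s' x = j ->
     (forall y, y != x -> ivar s' y = ivar s y) ->
     (forall a', a' != a -> forall i j, cell s' a' i j = cell s a' i j) ->
     (forall i' j', (i' != r) || (j <= j')%N -> cell s' a i' j' = cell s a i' j') ->
     ieval s' i = r /\ reval s' e = f j) ->
  runs (For x b (RSet a i (IVar x) e)) s
    (fun s' => forall i' j,
       cell s' a i' j = if (i' == r) && (j < k)%N then f j else cell s a i' j)
    (6 + k * ((icost i + 1 + rcost e).+1 + 8)).
Proof.
move=> sb bx H.
apply: (runs_for (n := k) (Inv := fun j s' => forall i' j',
  cell s' a i' j' = if (i' == r) && (j' < j)%N then f j' else cell s a i' j')) => //.
- by rewrite inE.
- by move=> i' j'; rewrite andbF.
- move=> j s' jk xj [fi fa] inv; apply: runs_rset.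
  have [|||||-> ->] := H j s' => //.
  + by move=> y yx; apply: fi; rewrite [ivars_of _]/= !inE (negPf yx).
  + by move=> a' aa'; apply: fa; rewrite [arrays_of _]/= !inE (negPf aa').
  + move=> i' j' h; rewrite inv; case: andP => // -[ir jj].
    by rewrite ir /= leqNgt jj in h.
  + move=> i' j' /=; rewrite eqxx /= xj inv ltnS.
    by case: (i' == r); case: ltngtP => // ->.
Qed.

Lemma runs_dot_vector x d s (b : 'I_V) :
  dims s -> ivar s x = b -> x != i_l ->
  runs (dot_vector x d) s (fun s' =>
    cell s' a_sc 0 d = dot (functional s) (row b (mat s)) /\
    forall i j, (i, j) != (0%N, d) -> cell s' a_sc i j = cell s a_sc i j)
    (60 * V).
Proof.
move=> [_ _ sV] xb xl; apply: runs_le.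
  apply: runs_seq_rset => /=.
  apply: (runs_for (n := V) (Inv := fun k s' =>
    cell s' a_sc 0 d = \sum_(l < k) cell s a_mat b l * cell s a_fun 0 l /\
    forall i j, (i, j) != (0%N, d) -> cell s' a_sc i j = cell s a_sc i j)) => //.
  - rewrite /= !eqxx big_ord0; split=> // i j; rewrite xpair_eqE.
    by case: eqP => //= _; case: eqP.
  - move=> k s' kV xk [fi fa] [e o]; apply: runs_rset => /=; split.
      rewrite !eqxx e big_ord_recr /= !fa // xk fi ?xb //.
      by rewrite [ivars_of _]/= !inE (negPf xl).
    move=> i j ij; rewrite -o //; move: ij; rewrite xpair_eqE.
    by case: eqP => //= _; case: eqP.
  - move=> s' _ [e o]; split=> //; rewrite e dotE; apply: eq_bigr => l _.
    by rewrite !mxE.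
by rewrite /=; lia.
Qed.

Lemma runs_pivot_vector s (c : 'I_V) :
  dims s -> ivar s i_c = c ->
  runs pivot_vector s (fun s' => mat s' = pivot (functional s) c (mat s)) (300 * V ^ 2).
Proof.
move=> ds sc; apply: runs_le.
  apply: runs_seq; first exact: (runs_dot_vector 0 ds sc).
  move=> s1 fr1 [r1 _]; have ds1 := dims_framed fr1 isT ds.
  have [fi1 fa1] := fr1; have sc1 : ivar s1 i_c = c by rewrite fi1.
  set r := dot _ _ in r1; apply: runs_if => /= hr.
    apply: runs_skip; rewrite r1 -expr2 in hr.
    have r0 : r = 0 by apply/eqP; rewrite -sqrf_eq0 eq_le hr sqr_ge0.
    by rewrite pivot0 //; apply/matrixP=> b l; rewrite !mxE fa1.
  have r0 : r != 0 by apply: contraNneq hr; rewrite r1 => ->; rewrite mulr0.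
  apply: runs_seq.
    apply: (runs_fill (k := V) (r := 0%N) (f := cell s a_mat c)) => //.
      by case: ds1.
    by move=> j s' jV xj fi fa _; split=> //=; rewrite fi // sc1 xj fa // fa1.
  move=> s2 fr2 col2; have ds2 := dims_framed fr2 isT ds1; have [fi2 fa2] := fr2.
  apply: (runs_for (n := V) (Inv := fun k s' => cell s' a_sc 0 0 = r /\
    forall b l : 'I_V, mat s' b l =
      if (b < k)%N then pivot (functional s) c (mat s) b l else mat s b l)) => //.
  - by case: ds2.
  - by split=> [|b l]; rewrite /= ?mxE fa2 // fa1.
  - move=> k s3 kV xk fr3 [r3 inv3]; have ds3 := dims_framed fr3 isT ds2.
    have [fi3 fa3] := fr3.
    apply: runs_seq; first exact: (runs_dot_vector (b := Ordinal kV) 1 ds3 xk).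
    move=> s4 fr4 [d4 o4]; have [fi4 fa4] := fr4.
    have {}d4 : cell s4 a_sc 0 1 = dot (functional s) (row (Ordinal kV) (mat s)).
      rewrite d4; congr (dot _ _).
        by apply: eq_vec => l _; rewrite fa3 // fa2 // fa1.
      by apply/rowP=> l; rewrite [LHS]mxE inv3 /= ltnn [RHS]mxE.
    apply: runs_seq.
      apply: (runs_rdiv (Q := fun s' => cell s' a_sc 0 0 = r /\
        cell s' a_sc 0 1 = dot (functional s) (row (Ordinal kV) (mat s)) / r)) => /=.
        by rewrite o4 ?r3.
      by rewrite o4 // r3 d4.
    move=> s5 fr5 [r5 d5]; have [fi5 fa5] := fr5.
    apply: runs_post.
      apply: (runs_fill (k := V) (r := k) (f := fun l => cell s a_mat k l -
        dot (functional s) (row (Ordinal kV) (mat s)) / r * cell s a_mat c l)) => //.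
        by case: ds3; rewrite fi5 // fi4.
      move=> l s6 lV xl fi fa fo; split=> /=; first by rewrite fi // fi5 // fi4.
      rewrite fi // fi5 // fi4 // xk xl fo ?leqnn ?orbT // fa5 // fa4 //.
      have := inv3 (Ordinal kV) (Ordinal lV); rewrite !mxE /= ltnn => ->.
      rewrite fa // d5 fa // fa5 // fa4 // fa3 // col2 /= lV //.
    move=> s6 [fi6 fa6] inv6; split; first by rewrite fa6.
    move=> b l; rewrite mxE /= inv6 ltn_ord andbT ltnS leq_eqVlt.
    case: eqP => [bk|_] /=.
      by have -> : b = Ordinal kV by [apply: val_inj]; rewrite pivotE !mxE.
    by rewrite fa5 // fa4 //; have := inv3 b l; rewrite mxE => ->.
  - move=> s3 _ [_ inv3]; by apply/matrixP=> b l; rewrite inv3 ltn_ord.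
by rewrite /=; nia.
Qed.

Lemma runs_reset s : dims s ->
  runs reset s (fun s' => mat s' = start R hom) (50 * V ^ 2).
Proof.
move=> ds; apply: runs_le.
  apply: runs_seq.
    apply: (runs_for (n := V) (Inv := fun k s' => forall b l : 'I_V, (b < k)%N ->
      cell s' a_mat b l = (b == l)%:R)
      (Q := fun s' => forall b l : 'I_V, cell s' a_mat b l = (b == l)%:R)) => //.
    - by case: ds.
    - move=> k s1 kV xk fr1 inv; have [fi1 fa1] := fr1.
      apply: runs_seq.
        apply: (runs_fill (k := V) (r := k) (f := fun=> 0)) => //.
          by rewrite fi1 //; case: ds.
        by move=> j s2 jV xj fi fa fo; split=> //=; rewrite fi.
      move=> s2 [fi2 fa2] h2; apply: runs_rset => b l /=.
      rewrite ltnS leq_eqVlt !h2 fi2 // xk ltn_ord andbT.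
      rewrite -val_eqE /=; case: (eqVneq (b : nat) k) => [->|bk] /= h.
        by rewrite eq_sym; case: eqP.
      by rewrite inv // -val_eqE.
    - by move=> s' _ h b l; apply: h.
  move=> s1 fr1 h1; apply: runs_rset; apply/matrixP=> b l; rewrite !mxE /=.
  have [_ -> _] := dims_framed fr1 isT ds.
  rewrite h1 -!val_eqE /= sub0r.
  have [->|bN] := eqVneq (b : nat) N; first by rewrite /= eq_sym; case: eqP.
  by rewrite /=; case: eqP.
by rewrite /=; nia.
Qed.

Lemma runs_load_row s : dims s ->
  runs load_row s (fun s' => functional s' = row_of s (ivar s i_k)) (30 * V).
Proof.
move=> ds; apply: runs_le.
  apply: runs_post.
    apply: (runs_fill (k := V) (r := 0%N) (f := cell s a_rows (ivar s i_k))) => //.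
      by case: ds.
    by move=> j s1 jV xj fi fa fo; split=> //=; rewrite fi // xj fa.
  by move=> s1 fr1 h1; apply: eq_vec => l lV; rewrite h1 eqxx lV.
by rewrite /=; nia.
Qed.

Lemma runs_load_dpart x s (b : 'I_V) : dims s -> ivar s x = b -> x != i_l ->
  runs (load_dpart x) s
    (fun s' => functional s' = dpart dcoord (row b (mat s))) (100 * V).
Proof.
move=> ds xb xl; apply: runs_le.
  apply: runs_seq.
    apply: (runs_fill (k := V) (r := 0%N) (f := cell s a_mat b)) => //.
      by case: ds.
    by move=> j s1 jV xj fi fa fo; split=> //=; rewrite xj fa // fi // xb.
  move=> s1 fr1 h1; have ds1 := dims_framed fr1 isT ds; apply: runs_seq.
    by apply: (runs_fill (k := N) (r := 0%N) (f := fun=> 0)) => //; case: ds1.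
  move=> s2 fr2 h2; have ds2 := dims_framed fr2 isT ds1; apply: runs_rset.
  apply/rowP=> l; rewrite !mxE /= h2 h1 /= ltn_ord /dcoord.
  by have [_ -> _] := ds2; case: (ltngtP l N).
by rewrite /=; nia.
Qed.

Lemma runs_sweep S s : dims s -> parametrizes hom S (mat s) ->
  runs sweep s (fun s' => parametrizes hom (functional s :: S) (mat s')) (400 * V ^ 3).
Proof.
move=> ds sS; apply: runs_le.
  apply: (runs_for (n := V) (Inv := fun k s' =>
    sweeping hom S (functional s) k (mat s'))) => //.
  - by case: ds.
  - exact: sweeping0.
  - move=> k s1 kV xk fr1 inv; have ds1 := dims_framed fr1 isT ds.
    have [fi1 fa1] := fr1; have [_ dN _] := ds1.
    apply: runs_ifeq; rewrite xk dN => kN.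
      apply: runs_skip; have kE : k = hom by [].
      by rewrite kE in inv *; apply: sweeping_skip.
    apply: runs_post; first exact: (runs_pivot_vector (c := Ordinal kV) ds1 xk).
    move=> s2 _ h2; rewrite -[mat _]/(mat s2) h2.
    have -> : functional s1 = functional s.
      by apply: eq_vec => l _; rewrite fa1.
    apply: (@sweeping_pivot _ _ _ _ _ (Ordinal kV)) => //.
    by apply/eqP => /(congr1 val).
  - by move=> s' _; apply: sweeping_end.
by rewrite /=; nia.
Qed.

Lemma runs_minimize S s : dims s -> parametrizes hom S (mat s) ->
  runs minimize s (fun s' => minimizing hom dcoord S V (mat s')) (500 * V ^ 3).
Proof.
move=> ds sS; apply: runs_le.
  apply: (runs_for (n := V) (Inv := fun k s' =>
    minimizing hom dcoord S k (mat s'))) => //.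
  - by case: ds.
  - exact: minimizing0.
  - move=> k s1 kV xk fr1 inv; have ds1 := dims_framed fr1 isT ds.
    have [_ dN _] := ds1.
    apply: runs_ifeq; rewrite xk dN => kN.
      apply: runs_skip; have kE : k = hom by [].
      by rewrite kE in inv *; apply: minimizing_skip.
    apply: runs_seq; first exact: (@runs_load_dpart i_c s1 (Ordinal kV)).
    move=> s2 fr2 h2; have ds2 := dims_framed fr2 isT ds1; have [fi2 fa2] := fr2.
    apply: runs_post; first apply: (runs_pivot_vector (c := Ordinal kV) ds2).
      by rewrite fi2.
    move=> s3 _; rewrite -[mat (set_ivar _ _ _)]/(mat s3) h2 => ->.
    have -> : mat s2 = mat s1 by apply/matrixP=> b l; rewrite !mxE fa2.
    apply: (@minimizing_pivot _ _ _ _ _ (Ordinal kV)) => //.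
    by apply/eqP => /(congr1 val).
by rewrite /=; nia.
Qed.

Definition selected s e k :=
  [seq row_of s j | j <- rev (iota 0 k) & 1 <= cell s a_mask e j].

Lemma runs_eliminate s : dims s -> mat s = start R hom ->
  runs eliminate s (fun s' =>
    parametrizes hom (selected s (ivar s i_e) (ivar s i_K)) (mat s'))
    (6 + ivar s i_K * (500 * V ^ 3)).
Proof.
move=> ds s0; apply: runs_le.
  apply: (runs_for (n := ivar s i_K) (Inv := fun k s' =>
    parametrizes hom (selected s (ivar s i_e) k) (mat s'))) => //.
  - by rewrite -[mat _]/(mat s) s0; apply: parametrizes_start.
  - move=> k s1 kV xk fr1 inv; have ds1 := dims_framed fr1 isT ds.
    have [fi1 fa1] := fr1.
    have e : selected s (ivar s i_e) k.+1 =
        if 1 <= cell s a_mask (ivar s i_e) k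
        then row_of s k :: selected s (ivar s i_e) k
        else selected s (ivar s i_e) k.
      by rewrite /selected -[k.+1]addn1 iotaD rev_cat /= add0n; case: ifP.
    apply: runs_if; rewrite /= fa1 // fi1 // xk e => h.
      rewrite h; apply: runs_seq; first exact: runs_load_row.
      move=> s2 fr2 h2; have ds2 := dims_framed fr2 isT ds1; have [fi2 fa2] := fr2.
      have h2' : functional s2 = row_of s k.
        by rewrite h2 xk; apply: eq_vec => l _; rewrite fa1.
      rewrite -h2'; apply: runs_sweep => //.
      by rewrite (_ : mat s2 = mat s1) //; apply/matrixP=> b l; rewrite !mxE fa2.
    by rewrite (negPf h); apply: runs_skip.
rewrite leq_add2l leq_mul2l; apply/orP; right.
by rewrite /=; nia.
Qed.

(** * Correctness of the search *)

Definition feasible_upto s k (w : 'rV[R]_V) :=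
  all (fun j => dot (row_of s j) w <= 0) (iota 0 k).

Lemma runs_check_feasible s : dims s ->
  runs check_feasible s (fun s' =>
    ivar s' i_ok = feasible_upto s (ivar s i_K) (row hom (mat s)) :> nat)
    (10 + ivar s i_K * (300 * V)).
Proof.
move=> ds; apply: runs_le.
  apply: runs_seq_iset.
  apply: (runs_for (n := ivar s i_K) (Inv := fun k s' =>
    ivar s' i_ok = feasible_upto s k (row hom (mat s)) :> nat)) => //.
  move=> k s1 kV xk fr1 inv; have ds1 := dims_framed fr1 isT ds.
  have [fi1 fa1] := fr1.
  apply: runs_seq; first exact: runs_load_row.
  move=> s2 fr2 h2; have ds2 := dims_framed fr2 isT ds1; have [fi2 fa2] := fr2.
  apply: runs_seq.
    by apply: (@runs_dot_vector i_N 0 s2 hom ds2) => //; case: ds2.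
  move=> s3 fr3 [r3 _]; have [fi3 fa3] := fr3.
  have e : cell s3 a_sc 0 0 = dot (row_of s k) (row hom (mat s)).
    rewrite r3 h2 xk; congr (dot _ _).
      by apply: eq_vec => l _; rewrite fa1.
    by apply/rowP=> l; rewrite !mxE fa2 // fa1.
  have eS : feasible_upto s k.+1 (row hom (mat s)) =
    feasible_upto s k (row hom (mat s)) && (dot (row_of s k) (row hom (mat s)) <= 0).
    by rewrite /feasible_upto -[k.+1]addn1 iotaD all_cat /= andbT.
  apply: runs_if; rewrite /= e eS => h.
    by apply: runs_skip; rewrite h andbT /= fi3 // fi2.
  by apply: runs_iset; rewrite /= (negPf h) andbF.
rewrite /=; nia.
Qed.

Definition best s : 'rV[R]_V := vec n m (cell s a_best 0).
Definition best_cost s : R := cell s a_best 1 0.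

Lemma runs_save s : dims s -> runs save s (fun s' => [/\ ivar s' i_found = 1%N,
    best s' = row hom (mat s) & best_cost s' = cell s a_sc 0 0]) (50 * V).
Proof.
move=> ds; have [_ dN dV] := ds; apply: runs_le.
  apply: runs_seq.
    apply: (runs_fill (k := V) (r := 0%N) (f := cell s a_mat N)) => //.
    by move=> j s1 jV xj fi fa fo; split=> //=; rewrite fi // dN xj fa.
  move=> s1 [fi1 fa1] h1; apply: runs_seq_rset; apply: runs_iset.
  rewrite /best_cost /= fa1 //; split=> //; apply/rowP=> l.
  by rewrite !mxE /= h1 /= ltn_ord.
by rewrite /=; nia.
Qed.

Lemma runs_compare s : dims s ->
  let w := row hom (mat s) in
  runs compare s (fun s' =>
    [/\ ivar s' i_found = ivar s i_found, best s' = best s,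
        best_cost s' = best_cost s &
        ivar s i_ok = 0%N \/ (0 < ivar s i_found)%N /\ best_cost s <= sqnorm dcoord w] \/
    [/\ (0 < ivar s i_ok)%N, ivar s' i_found = 1%N, best s' = w,
        best_cost s' = sqnorm dcoord w &
        (0 < ivar s i_found)%N -> sqnorm dcoord w <= best_cost s]) (400 * V).
Proof.
move=> ds w; apply: runs_le.
  apply: runs_seq.
    by apply: (@runs_load_dpart i_N s hom) => //; case: ds.
  move=> s1 fr1 h1; have ds1 := dims_framed fr1 isT ds; have [fi1 fa1] := fr1.
  have m1 : mat s1 = mat s by apply/matrixP=> b l; rewrite !mxE fa1.
  apply: runs_seq.
    by apply: (@runs_dot_vector i_N 0 s1 hom) => //; case: ds1.
  move=> s2 fr2 [r2 _]; have ds2 := dims_framed fr2 isT ds1; have [fi2 fa2] := fr2.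
  have m2 : mat s2 = mat s by rewrite -m1; apply/matrixP=> b l; rewrite !mxE fa2.
  have {}r2 : cell s2 a_sc 0 0 = sqnorm dcoord w by rewrite r2 h1 m1.
  have c2 : best_cost s2 = best_cost s by rewrite /best_cost fa2 // fa1.
  have b2 : best s2 = best s by apply: eq_vec => l _; rewrite fa2 // fa1.
  have f2 : ivar s2 i_found = ivar s i_found by rewrite fi2 // fi1.
  have k2 : ivar s2 i_ok = ivar s i_ok by rewrite fi2 // fi1.
  have saves s' : [/\ ivar s' i_found = 1%N, best s' = row hom (mat s2) &
       best_cost s' = cell s2 a_sc 0 0] ->
     (0 < ivar s i_ok)%N -> ((0 < ivar s i_found)%N -> sqnorm dcoord w <= best_cost s) ->
     [/\ (0 < ivar s i_ok)%N, ivar s' i_found = 1%N, best s' = w,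
        best_cost s' = sqnorm dcoord w &
        (0 < ivar s i_found)%N -> sqnorm dcoord w <= best_cost s].
    by rewrite m2 r2 => -[-> -> ->].
  apply: runs_if => /=; rewrite k2 leqn0 => ok.
    by apply: runs_skip; left; split=> //; left; apply/eqP.
  rewrite -lt0n in ok; apply: runs_if => /=; rewrite f2 leqn0 => found.
    apply: runs_post; first exact: (runs_save ds2).
    move=> s3 _ h3; right; apply: saves => //.
    by rewrite (eqP found).
  rewrite -lt0n in found; apply: runs_if => /=.
    rewrite -[cell _ _ 1 0]/(best_cost s2) c2 r2 => le.
    by apply: runs_skip; left; split=> //; right.
  rewrite -[cell _ _ 1 0]/(best_cost s2) c2 r2 => le.
  apply: runs_post; first exact: (runs_save ds2).
  move=> s3 _ h3; right; apply: saves => // _.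
  by rewrite -ltNge in le; apply: ltW.
by rewrite /=; nia.
Qed.

Definition all_rows s := [seq row_of s j | j <- iota 0 (ivar s i_K)].

Lemma feasible_uptoP s (w : 'rV[R]_V) : w ord0 hom = -1 ->
  feasible_upto s (ivar s i_K) w <-> feasible hom (all_rows s) w.
Proof.
move=> wo; split=> [/allP h|[_ h]]; first by split=> // _ /mapP[j /h jK ->].
by apply/allP => j jK; apply: h; apply: map_f.
Qed.

Lemma runs_search s : dims s -> ivar s i_found = 0%N ->
  runs search s (fun s' =>
    ((0 < ivar s' i_found)%N ->
       feasible hom (all_rows s) (best s') /\ best_cost s' = sqnorm dcoord (best s')) /\
    forall e, (e < ivar s i_E)%N ->
      exists w, is_minimizer hom dcoord (selected s e (ivar s i_K)) w /\
        (feasible hom (all_rows s) w ->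
           (0 < ivar s' i_found)%N /\ best_cost s' <= sqnorm dcoord w))
  (6 + ivar s i_E * (2000 * V ^ 3 * (ivar s i_K).+1)).
Proof.
move=> ds f0; apply: runs_le.
  apply: (runs_for (n := ivar s i_E) (Inv := fun k s' =>
    ((0 < ivar s' i_found)%N ->
       feasible hom (all_rows s) (best s') /\ best_cost s' = sqnorm dcoord (best s')) /\
    forall e, (e < k)%N ->
      exists w, is_minimizer hom dcoord (selected s e (ivar s i_K)) w /\
        (feasible hom (all_rows s) w ->
           (0 < ivar s' i_found)%N /\ best_cost s' <= sqnorm dcoord w))) => //.
    by rewrite /= f0.
  move=> e s1 eE xe fr1 [good1 min1]; have ds1 := dims_framed fr1 isT ds.
  have [fi1 fa1] := fr1; have K1 : ivar s1 i_K = ivar s i_K by rewrite fi1.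
  apply: runs_seq; first exact: runs_reset.
  move=> s2 fr2 h2; have ds2 := dims_framed fr2 isT ds1; have [fi2 fa2] := fr2.
  have K2 : ivar s2 i_K = ivar s i_K by rewrite fi2.
  apply: runs_seq; first by have := runs_eliminate ds2 h2; rewrite K2; apply.
  move=> s3 fr3 h3; have ds3 := dims_framed fr3 isT ds2; have [fi3 fa3] := fr3.
  apply: runs_seq; first exact: (runs_minimize ds3 h3).
  move=> s4 fr4 h4; have ds4 := dims_framed fr4 isT ds3; have [fi4 fa4] := fr4.
  have K4 : ivar s4 i_K = ivar s i_K by rewrite fi4 // fi3.
  apply: runs_seq; first by have := runs_check_feasible ds4; rewrite K4; apply.
  move=> s5 fr5 h5; have ds5 := dims_framed fr5 isT ds4; have [fi5 fa5] := fr5.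
  apply: runs_post; first exact: (runs_compare ds5).
  move=> s6 fr6; set w := row hom (mat s5).
  have minw : is_minimizer hom dcoord (selected s e (ivar s i_K)) w.
    have -> : w = row hom (mat s4) by apply/rowP=> l; rewrite !mxE fa5.
    have -> : selected s e (ivar s i_K) =
        selected s2 (ivar s2 i_e) (ivar s i_K).
      rewrite /selected fi2 // xe.
      rewrite (eq_filter (a2 := fun j => 1 <= cell s2 a_mask e j)); last first.
        by move=> j; rewrite fa2 // fa1.
      by apply: eq_map => j; apply: eq_vec => l _; rewrite fa2 // fa1.
    by apply: minimizing_end.
  have okP : (0 < ivar s5 i_ok)%N <-> feasible hom (all_rows s) w.
    rewrite -feasible_uptoP; last by case: minw.
    rewrite h5 lt0b -K4; have -> : w = row hom (mat s4).
      by apply/rowP=> l; rewrite !mxE fa5.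
    rewrite (_ : feasible_upto s4 _ _ = feasible_upto s (ivar s4 i_K) (row hom (mat s4))).
      by rewrite K4.
    apply: eq_all => j; congr (dot _ _ <= 0).
    by apply: eq_vec => l _; rewrite fa4 // fa3 // fa2 // fa1.
  have f5 : ivar s5 i_found = ivar s1 i_found by rewrite fi5 // fi4 // fi3 // fi2.
  have b5 : best s5 = best s1.
    by apply: eq_vec => l _; rewrite fa5 // fa4 // fa3 // fa2.
  have c5 : best_cost s5 = best_cost s1.
    by rewrite /best_cost fa5 // fa4 // fa3 // fa2.
  rewrite f5 b5 c5 -[best (set_ivar _ _ _)]/(best s6).
  rewrite -[best_cost (set_ivar _ _ _)]/(best_cost s6) /= -/w.
  case=> [[-> -> -> keep] | [ok -> -> -> le]]; split=> //.
  - move=> e'; rewrite ltnS leq_eqVlt => /predU1P[->|]; last exact: min1.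
    exists w; split=> // /okP; case: keep => [->|] //.
  - by move=> _; split=> //; apply/okP.
  - move=> e'; rewrite ltnS leq_eqVlt => /predU1P[->|/min1]; first by exists w.
    move=> [w' [mw' fw']]; exists w'; split=> // /fw'[found le'].
    by split=> //; apply: le_trans le'; apply: le.
rewrite leq_add2l leq_mul2l; apply/orP; right.
rewrite /=; nia.
Qed.

(** * Building the rows and the masks, writing the output *)

Definition built pt L s := ivar s i_K = size L /\
  forall k l, cell s a_rows k l =
    if (k < size L)%N then coef n pt (nth (0, 0, 0)%N L k) l else 0.

Lemma runs_add_row pt L s (nu i j : nat) : dims s ->
  ivar s i_nu = nu -> ivar s i_i = i -> ivar s i_j = j ->
  (forall nu i, cell s a_pts nu i = pt nu i) ->
  built pt L s -> runs add_row s (built pt (rcons L (nu, i, j))) 100.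
Proof.
move=> [_ dN _] enu ei ej ept [eK eA]; apply: runs_le.
  do 4 apply: runs_seq_rset; apply: runs_iset.
  split; rewrite /= size_rcons ?eK ?addn1 // => k l.
  rewrite ltnS leq_eqVlt eA nth_rcons dN enu ei ej !ept /= sub0r.
  by case: (ltngtP k (size L)) => //= _; rewrite addn1.
by [].
Qed.

Lemma runs_build_rows s : dims s -> ivar s i_K = 0%N ->
  (forall k l, cell s a_rows k l = 0) ->
  runs build_rows s (built (cell s a_pts) (indices n m)) (300 * V ^ 3).
Proof.
move=> ds K0 A0; have [dm dN dV] := ds; apply: runs_le.
  apply: (runs_for (n := m) (Inv := fun k s' =>
    built (cell s a_pts) (indices_nu n k) s')) => //.
  move=> nu s1 num xnu fr1 inv1; have ds1 := dims_framed fr1 isT ds.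
  have [fi1 fa1] := fr1.
  have -> : indices_nu n nu.+1 = indices_nu n nu ++ indices_i n nu N.
    by rewrite /indices_nu -[nu.+1]addn1 iotaD map_cat flatten_cat /= cats0.
  apply: (runs_for (n := N) (Inv := fun k s' =>
    built (cell s a_pts) (indices_nu n nu ++ indices_i n nu k) s')) => //.
  - by case: ds1.
  - by rewrite cats0.
  move=> i s2 iN xi fr2 inv2; have ds2 := dims_framed fr2 isT ds1.
  have [fi2 fa2] := fr2.
  have -> : indices_i n nu i.+1 = indices_i n nu i ++ indices_j nu i N.
    by rewrite /indices_i -[i.+1]addn1 iotaD map_cat flatten_cat /= cats0.
  apply: (runs_for (n := N) (Inv := fun k s' =>
    built (cell s a_pts)
      (indices_nu n nu ++ indices_i n nu i ++ indices_j nu i k) s')) => //.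
  - by case: ds2.
  - by rewrite cats0.
  move=> j s3 jN xj fr3 inv3; have ds3 := dims_framed fr3 isT ds2.
  have [fi3 fa3] := fr3.
  have ei : ivar s3 i_i = i by rewrite fi3.
  have -> : indices_j nu i j.+1 =
      indices_j nu i j ++ if j != i then [:: (nu, i, j)] else [::].
    by rewrite /indices_j -[j.+1]addn1 iotaD filter_cat map_cat /=; case: ifP.
  apply: runs_ifeq; rewrite xj ei => ij.
    by apply: runs_skip; rewrite (_ : (j != i) = false) ?cats0 // ij eqxx.
  have -> : j != i by apply/eqP => h; apply: ij; rewrite h.
  rewrite !catA in inv3 *; rewrite cats1.
  apply: runs_add_row => //.
    by rewrite fi3 // fi2.
  by move=> nu' i'; rewrite fa3 // fa2 // fa1.
rewrite /=; nia.
Qed.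

(** The half of the list that was there before a doubling has 0 in the new
    column, because that column has never been written. *)
Lemma runs_build_masks s :
  (forall e c, cell s a_mask e c = 0) ->
  runs build_masks s (fun s' => ivar s' i_E = (2 ^ ivar s i_K)%N /\
    forall act : pred nat, exists e, (e < 2 ^ ivar s i_K)%N /\
      forall c, (c < ivar s i_K)%N -> (1 <= cell s' a_mask e c) = act c)
  (100 * (2 ^ ivar s i_K * (ivar s i_K).+1 ^ 2)).
Proof.
move=> M0; set K := ivar s i_K; apply: runs_le.
  apply: runs_seq_iset.
  apply: (runs_for (n := K) (T := (30 + 2 ^ K * (60 + 40 * K))%N)
    (Inv := fun k s' =>
    [/\ ivar s' i_E = (2 ^ k)%N,
    forall act : pred nat, exists e, (e < 2 ^ k)%N /\
      forall c, (c < k)%N -> (1 <= cell s' a_mask e c) = act c &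
    forall e c, (k <= c)%N -> cell s' a_mask e c = 0])) => //.
  - split=> [//|act|e c _]; [by exists 0%N | exact: M0].
  - move=> k s1 kK xk fr1 [E1 act1 z1]; have [fi1 fa1] := fr1.
    apply: runs_le.
      apply: (runs_seq (Q1 := fun s' => forall e c, cell s' a_mask e c =
             if (2 ^ k <= e < 2 ^ k + 2 ^ k)%N then
               if (c < k)%N then cell s1 a_mask (e - 2 ^ k)%N c else (c == k)%:R
             else cell s1 a_mask e c)).
        apply: (runs_for (n := (2 ^ k)%N) (T := (60 + 30 * K)%N)
          (Inv := fun j s' => forall e c, cell s' a_mask e c =
             if (2 ^ k <= e < 2 ^ k + j)%N then
               if (c < k)%N then cell s1 a_mask (e - 2 ^ k)%N c else (c == k)%:R
             else cell s1 a_mask e c)) => //.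
        - by move=> e c; rewrite addn0 /=; case: ifP => //; lia.
        - move=> j s2 jE xj fr2 inv2; have [fi2 fa2] := fr2.
          apply: runs_le.
            apply: runs_seq.
              apply: (runs_fill (k := k) (r := (2 ^ k + j)%N)
                (f := cell s1 a_mask j)) => //.
                by rewrite fi2.
              move=> c s3 ck xc fi fa fo.
              rewrite /= (fi i_E) // (fi i_e) // fi2 // xj E1 xc.
              split=> //; rewrite fo; last by have := expn_gt0 2 k; lia.
              by rewrite inv2; case: ifP => //; lia.
            move=> s3 [fi3 fa3] h3; apply: runs_rset => e c /=.
            rewrite !fi3 // xj !fi2 // xk E1 h3 inv2.
            case: (eqVneq e (2 ^ k + j)%N) => [->|ne] /=.
              rewrite addnS ltnS leqnn leq_addr /= [(2 ^ k + j - _)%N]addKn.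
              case: (ltngtP c k) => //= kc; by case: ifP => _; rewrite ?z1 // ltnW.
            rewrite (_ : (2 ^ k <= e < 2 ^ k + j.+1) = (2 ^ k <= e < 2 ^ k + j))%N //.
            by lia.
          rewrite /=; nia.
      move=> s2 fr2 h2; have [fi2 fa2] := fr2; apply: runs_iset.
      rewrite /= fi2 // E1 expnS mul2n addnn; split=> //.
      + move=> act; have [e [eE he]] := act1 act.
        case actk : (act k).
          exists (2 ^ k + e)%N; split; first by rewrite -addnn ltn_add2l.
          move=> c; rewrite ltnS leq_eqVlt h2 leq_addr ltn_add2l eE /= addKn.
          by case: (ltngtP c k) => //= [/he//|->] _; rewrite lexx actk.
        exists e; split; first by rewrite -addnn ltn_addr.
        move=> c; rewrite ltnS leq_eqVlt h2 [(2 ^ k <= e)%N]leqNgt eE /=.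
        by case: (ltngtP c k) => //= [/he//|->] _; rewrite z1 // ler10 actk.
      + move=> e c kc; rewrite h2; case: ifP => _; last by rewrite z1 // ltnW.
        by rewrite ltnNge ltnW //= gtn_eqF.
    have le2 : (2 ^ k <= 2 ^ K)%N by rewrite leq_exp2l // ltnW.
    rewrite /=; nia.
  - by move=> s' _ [e a _].
have := expn_gt0 2 K; rewrite /=; nia.
Qed.

Lemma runs_finish s : dims s ->
  runs finish s (fun s' => [/\ ivar s' i_m = 0%N, ivar s' i_N = ivar s i_K &
    forall k l, cell s' a_rows k l =
      if (k < ivar s i_K)%N && (l == N) then cell s a_rows k N -
        \sum_(nu < m) cell s a_rows k (N.+1 + nu)%N * cell s a_best 0 (N.+1 + nu)%N
      else cell s a_rows k l])
    (20 + ivar s i_K * (100 * V)).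
Proof.
move=> ds; apply: runs_le.
  apply: runs_seq.
    pose inv k (s' : state R) := forall k' l, cell s' a_rows k' l =
      if (k' < k)%N && (l == N) then cell s a_rows k' N -
        \sum_(nu < m) cell s a_rows k' (N.+1 + nu)%N * cell s a_best 0 (N.+1 + nu)%N
      else cell s a_rows k' l.
    apply: (runs_for (n := ivar s i_K) (Inv := inv) (Q := inv (ivar s i_K))) => //.
    move=> k s1 kK xk fr1 inv1; have ds1 := dims_framed fr1 isT ds.
    have [fi1 fa1] := fr1.
    apply: (runs_for (n := m) (Inv := fun j s' => forall k' l,
      cell s' a_rows k' l =
      if (k' == k) && (l == N) then cell s a_rows k N -
        \sum_(nu < j) cell s a_rows k (N.+1 + nu)%N * cell s a_best 0 (N.+1 + nu)%N
      else cell s1 a_rows k' l)).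
    - by case: ds1.
    - by [].
    - by [].
    - move=> k' l /=; rewrite big_ord0 subr0; case: andP => // -[/eqP-> /eqP->].
      by rewrite inv1 ltnn.
    - move=> j s2 jm xj fr2 inv2; have [fi2 fa2] := fr2; apply: runs_rset.
      have [_ dN2 _] := dims_framed fr2 isT ds1.
      move=> k' l /=; rewrite dN2 fi2 // xk xj addn1 !inv2 !eqxx /=.
      rewrite [(N.+1 + j == N)%N]gtn_eqF ?leq_addr //= inv1 ltnn /=.
      rewrite fa2 // fa1 // big_ord_recr /= opprD addrA.
      by case: (_ && _).
    - move=> s2 _ h2 k' l; rewrite h2 inv1 [(k' < k.+1)%N]ltnS.
      rewrite [(k' <= k)%N]leq_eqVlt /=.
      by case: (eqVneq k' k) => [->|_] /=; case: eqP; rewrite ?andbF ?ltnn.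
  move=> s1 fr1 h1; have [fi1 fa1] := fr1.
  apply: runs_seq_iset; apply: runs_iset; split=> //=.
  by rewrite fi1.
have [_ _ _] := ds; rewrite /=; nia.
Qed.

(** * Correctness and running time of the whole program *)

Lemma is_minimizer_eq_mem (S S' : seq 'rV[R]_V) w :
  S =i S' -> is_minimizer hom dcoord S w -> is_minimizer hom dcoord S' w.
Proof.
move=> SS' [wo mw]; split=> // z zo hz.
have [|hw qw] := mw z zo; first by move=> a; rewrite SS'; apply: hz.
by split=> // a; rewrite -SS'; apply: hw.
Qed.

(** Moving the d-part to the right-hand side turns an inequality evaluated at
    the point (x, -1, d) into a row of the output. *)
Lemma output_set_finish s s' :
  [/\ ivar s' i_m = 0%N, ivar s' i_N = ivar s i_K &
    forall k l, cell s' a_rows k l =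
      if (k < ivar s i_K)%N && (l == N) then cell s a_rows k N -
        \sum_(nu < m) cell s a_rows k (N.+1 + nu)%N * cell s a_best 0 (N.+1 + nu)%N
      else cell s a_rows k l] ->
  forall x, output_set s' x <->
    feasible hom (all_rows s) (point x (d_of (best s))).
Proof.
move=> [m0 eK eA] x.
have ineqP k : (k < ivar s i_K)%N ->
    (output_lhs s' a_rows k x <= cell s' a_rows k N) =
    (dot (row_of s k) (point x (d_of (best s))) <= 0).
  move=> kK; rewrite dotE sum_coord point_hom /output_lhs eA kK eqxx /=.
  rewrite lerBrDr -subr_le0; congr (_ <= 0); rewrite mulN1r [vec _ _ _ _ hom]mxE.
  rewrite [RHS]addrAC; congr (_ + _ - _).
    apply: eq_bigr => j _; rewrite eA kK ltn_eqF //= mulrC.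
    have /rowP/(_ j) := x_of_point x (d_of (best s)); rewrite mxE => ->.
    by rewrite mxE.
  apply: eq_bigr => nu _; have := d_of_point x (d_of (best s)) nu.
  by rewrite {1}/d_of => ->; rewrite /d_of !mxE mulrC.
split=> [[_ h]|[_ h]]; split.
- exact: point_hom.
- move=> _ /mapP[k + ->]; rewrite mem_iota => /= kK.
  by rewrite -ineqP //; apply: h; rewrite eK.
- by move=> k; rewrite m0.
- move=> k; rewrite eK => kK; rewrite ineqP //; apply: h.
  by apply: map_f; rewrite mem_iota.
Qed.

Lemma runs_frechet_program (p : 'I_m -> 'rV[R]_N) (m0 : (0 < m)%N) :
  runs frechet_program (input p)
    (fun s => forall x, output_set s x <->
      FM_polytope (fun nu => \pi_(torus R n) (p nu)) (\pi_(torus R n) x))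
    (3000 * (2 ^ (m * (N * n)) * V ^ 6)).
Proof.
apply: runs_le.
  apply: runs_seq_iset; set s1 := set_ivar _ _ _.
  have ds1 : dims s1 by split; rewrite /= ?addn1.
  pose pt := cell s1 a_pts.
  have ptE (nu : 'I_m) (i : 'I_N) : pt nu i = p nu ord0 i.
    by rewrite /pt /= !valK.
  apply: runs_seq; first exact: (runs_build_rows ds1).
  move=> s2 fr2 [K2 rows2]; have ds2 := dims_framed fr2 isT ds1.
  have [fi2 fa2] := fr2; rewrite size_indices in K2.
  have mask0 e c : cell s2 a_mask e c = 0 by rewrite fa2.
  apply: runs_seq; first by have := runs_build_masks mask0; rewrite K2; apply.
  move=> s3 fr3 [E3 mask3]; have ds3 := dims_framed fr3 isT ds2.
  have [fi3 fa3] := fr3; have K3 : ivar s3 i_K = (m * (N * n))%N by rewrite fi3.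
  have rows3 : all_rows s3 = rows n m pt.
    rewrite /all_rows /rows K3 -size_indices -[indices n m in RHS](mkseq_nth (0, 0, 0)%N).
    rewrite -map_comp; apply/eq_in_map => k; rewrite mem_iota add0n => /= kK.
    by apply: eq_vec => l _; rewrite fa3 // rows2 kK.
  apply: runs_seq.
    have f3 : ivar s3 i_found = 0%N by rewrite fi3 // fi2.
    by have := runs_search ds3 f3; rewrite E3 K3; apply.
  move=> s4 fr4 [good4 min4]; have ds4 := dims_framed fr4 isT ds3.
  have [fi4 fa4] := fr4; have K4 : ivar s4 i_K = (m * (N * n))%N by rewrite fi4.
  have rows4 : all_rows s4 = rows n m pt.
    rewrite -rows3 /all_rows K3 K4; apply: eq_map => k.
    by apply: eq_vec => l _; rewrite fa4.
  apply: runs_post; first by have := runs_finish ds4; rewrite K4; apply.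
  move=> s5 _; rewrite -K4 => /output_set_finish out x; rewrite out rows4.
  have opt z : feasible hom (rows n m pt) z ->
      (0 < ivar s4 i_found)%N /\ best_cost s4 <= sqnorm dcoord z.
    move=> fz; have [|w [le_w fw le_z]] := @feasible_face_minimizer _ _ hom
        dcoord (rows n m pt) (fun w => feasible hom (rows n m pt) w ->
          (0 < ivar s4 i_found)%N /\ best_cost s4 <= sqnorm dcoord w) _ z fz.
      move=> act; have [e [eE he]] :=
        mask3 (fun j => (j < m * (N * n))%N && act (row_of s3 j)).
      have [w [mw hw]] := min4 e eE.
      exists w; split; first by rewrite -rows3.
      apply: is_minimizer_eq_mem mw => a; rewrite -rows3 /selected /all_rows K3.
      rewrite filter_map; apply/mapP/mapP => -[j jK ->]; exists j => //;
        move: jK; rewrite !mem_filter /= ?mem_rev !mem_iota /= add0n.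
        by move=> /andP[+ jK]; rewrite he // jK andbT.
      by move=> /andP[aj jK]; rewrite he // jK andbT.
    by have [found le] := le_w fw; split=> //; apply: le_trans le_z.
  have fx : feasible hom (rows n m pt)
      (point (p (Ordinal m0)) (fun nu => vec_dtr (p (Ordinal m0)) (p nu))).
    apply/(feasible_fits ptE); rewrite point_hom x_of_point; split=> // nu i j ij.
    by rewrite d_of_point; apply: fits_dtr.
  have [found _] := opt _ fx.
  have [fbest cbest] := good4 found; rewrite rows3 in fbest.
  apply: (FM_polytope_minimizer ptE fbest) => z fz.
  by rewrite -cbest; apply: (opt z fz).2.
have K1 : ((m * (N * n)).+1 <= V ^ 3)%N by rewrite /=; nia.
have V1 : (V <= V ^ 3)%N by rewrite -{1}[V]expn1 leq_pexp2l.
have -> : (V ^ 6 = V ^ 3 * V ^ 3)%N by rewrite -expnD.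
have E1 : (0 < 2 ^ (m * (N * n)))%N by rewrite expn_gt0.
move: (m * (N * n))%N (2 ^ _)%N (V ^ 3)%N V1 K1 E1 => K E W V1 K1 E1 /=.
have h1 : (K.+1 ^ 2 <= W * W)%N by rewrite expnS expn1 leq_mul.
have h2 : (W * K.+1 <= W * W)%N by rewrite leq_mul2l K1 orbT.
have h3 : (K * V <= W * W)%N by rewrite leq_mul // ltnW.
have h4 : (W <= W * W)%N by nia.
have h5 : (E * (K.+1 ^ 2) <= E * (W * W))%N by rewrite leq_mul2l h1 orbT.
have h6 : (E * (W * K.+1) <= E * (W * W))%N by rewrite leq_mul2l h2 orbT.
have h7 : (W * W <= E * (W * W))%N by rewrite leq_pmull.
nia.
Qed.
End Correctness.

(** With r the least integer greater than v / e, v <= e 2^r, and e r <= v + e. *)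
Lemma expn_le_exp2 e : exists C, forall v, (v ^ e <= C * 2 ^ v)%N.
Proof.
case: e => [|e]; first by exists 1%N => v; rewrite expn0 mul1n expn_gt0.
exists (e.+1 ^ e.+1 * 2 ^ e.+1)%N => v.
set r := (v %/ e.+1).+1.
have le_v : (v <= e.+1 * 2 ^ r)%N.
  apply: leq_trans (ltnW (ltn_ceil v (ltn0Sn e))) _.
  by rewrite mulnC leq_mul2l /= ltnW // ltn_expl.
apply: (@leq_trans ((e.+1 * 2 ^ r) ^ e.+1)); first by rewrite leq_exp2r.
rewrite expnMn -expnM -mulnA leq_mul2l -expnD leq_exp2l //; apply/orP; right.
by rewrite mulSn leq_add2l leq_trunc_div.
Qed.

Theorem theorem32 (R : realType) :
  exists (P : cmd) (C : nat),
    forall (m n : nat) (p : 'I_m -> 'rV[R]_n.+1),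
      (0 < m)%N ->
      exists (s : state R) (t : nat),
        [/\ exec P (input p) s t,
            forall x : 'rV[R]_n.+1,
              output_set s x <->
              FM_polytope (fun nu => \pi_(torus R n) (p nu)) (\pi_(torus R n) x) &
            (t <= C * (2 ^ (m * n.+1 ^ 2 + n.+1) * (m * n.+1 ^ 3)))%N].
Proof.
have [C0 HC] := expn_le_exp2 6.
exists frechet_program, (3000 * (C0 * 2))%N => m n p m0.
have [s [t [e out le_t]]] := runs_frechet_program p m0.
exists s, t; split=> //; apply: leq_trans le_t _.
rewrite -[leqRHS]mulnA leq_mul2l; apply/orP; right.
set E := (m * n.+1 ^ 2 + n.+1)%N.
have le_E : (m * (n.+1 * n) + (n.+2 + m) <= E.+1)%N by rewrite /E; nia.
apply: (@leq_trans (C0 * 2 ^ E.+1)).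
  apply: (@leq_trans (2 ^ (m * (n.+1 * n)) * (C0 * 2 ^ (n.+2 + m)))).
    by rewrite leq_mul2l HC orbT.
  by rewrite mulnCA -expnD leq_mul2l leq_exp2l // le_E orbT.
by rewrite expnS mulnA leq_mul2l leq_pmulr ?orbT // muln_gt0 m0 expn_gt0.
Qed.
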